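(* Let $f\in\mathrm{Bound}(k,n)$ and suppose $\Pi_f=\bigcap_i\Pi_{f_i}$ where each $\Pi_{f_i}$ is a basic positroid variety. Then $B_f(n,k,d)=\bigcap_iB_{f_i}(n,k,d)$ for every $d\ge1$.
   Context: Let $\Bbbk$ be algebraically closed of characteristic $0$, $1\le k<n$. Points $V\in\mathrm{Gr}(k,n)$ are represented by $k\times n$ matrices with columns $v_1,\dots,v_n$, extended by $v_{i+n}=v_i$. $\mathrm{Bound}(k,n)$ is the set of bijections $f:\mathbb Z\to\mathbb Z$ with $f(i+n)=f(i)+n$, $\sum_{i=1}^n(f(i)-i)=kn$, $i\le f(i)\le i+n$. For $V$, $f_V(i)=\min\{j\ge i:v_i\in\operatorname{span}(v_{i+1},\dots,v_j)\}$, and $\Pi_f$ is the closure of $\{V:f_V=f\}$. For a cyclic interval $S$ of $[n]$ (a set $\{\alpha+1,\dots,\alpha+m\}$ read modulo $n$) and $r\ge0$, $X_{S\le r}=\{V:\operatorname{rank}(\text{columns indexed by }S)\le r\}$; such varieties are positroid varieties, called basic positroid varieties. $R(k,n)$ is the polynomial ring in Plücker variables $[\mathbf a]$, $\mathbf a\in\binom{[n]}{k}$, and $\mathcal J_f$ is the defining ideal of $\Pi_f$ under the Plücker embedding. Plücker poset: $\mathbf a\le\mathbf b$ iff $a_i\le b_i$ for all $i$. $<_\omega$ is degree revlex for a variable ordering that is a fixed linear extension of the Plücker poset (poset-larger variables larger); $\operatorname{In}$ is the initial ideal. $B(n,k,d)$ is the set of semistandard $k\times d$ rectangular tableaux with entries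 in $[n]$, identified with standard monomials $\prod_i[\mathbf a^{(i)}]$ ($\mathbf a^{(i)}$ the entries of column $i$), and $B_f(n,k,d)=\{\mathbf m\in B(n,k,d):\mathbf m\notin\operatorname{In}(\mathcal J_f)\}$. *)

(* Defs.v *)
From HB Require Import structures.
From mathcomp Require Import all_boot all_order all_algebra.
From mathcomp Require Import mpoly.
Set Implicit Arguments. Unset Strict Implicit. Unset Printing Implicit Defensive.
Import Order.TTheory GRing.Theory Num.Theory.
Local Open Scope ring_scope.

Definition isBound (k n : nat) (f : int -> int) : Prop :=
  [/\ bijective f,
      (forall i : int, f (i + n%:Z) = f i + n%:Z),
      \sum_(i < n) (f (i.+1)%:Z - (i.+1)%:Z) = (k * n)%:Z
    & (forall i : int, i <= f i <= i + n%:Z)].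

Section Grass.
Variables (K : fieldType) (k n : nat).

(* A point of Gr(k,n) is represented by a k x n matrix of rank k. *)
Definition Gr (V : 'M[K]_(k, n)) : Prop := \rank V = k.

(* Column v_z of V, for z : int, with v_{z+n} = v_z (column indices mod n,
   columns 0..n-1 standing for 1..n); written as a row vector. *)
Definition colv (V : 'M[K]_(k, n)) (z : int) : 'rV[K]_k :=
  \row_(a < k) \sum_(j < n | (j%:Z == (z %% n%:Z)%Z)) V a j.

Definition in_span (V : 'M[K]_(k, n)) (i j : int) : bool :=
  (colv V i <= \sum_(s < `|j - i|%N) <<colv V (i + (s.+1)%:Z)>>)%MS.

Definition fV_is (V : 'M[K]_(k, n)) (f : int -> int) : Prop :=
  forall i : int,
    [/\ i <= f i, in_span V i (f i)
      & forall j : int, i <= j -> j < f i -> ~~ in_span V i j].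

Definition KSub := {A : {set 'I_n} | #|A| == k}.
Definition N := #|{: KSub}|.

Definition entries (a : KSub) : seq nat := [seq val x | x <- enum (val a)].

Definition pleq (a b : KSub) : Prop :=
  forall i : 'I_k, (nth 0 (entries a) i <= nth 0 (entries b) i)%N.

Definition minor (V : 'M[K]_(k, n)) (a : KSub) : K :=
  \det (\matrix_(r < k, c < k)
          \sum_(j < n | (j \in val a) && (index j (enum (val a)) == c)) V r j).

Definition plucker (V : 'M[K]_(k, n)) : 'I_N -> K :=
  fun i => minor V (enum_val i).

Definition zclosure (S : 'M[K]_(k, n) -> Prop) : 'M[K]_(k, n) -> Prop :=
  fun V => Gr V /\
    forall p : {mpoly K[N]},
      (forall W, S W -> meval (plucker W) p = 0) -> meval (plucker V) p = 0.

Definition cell (f : int -> int) : 'M[K]_(k, n) -> Prop :=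
  fun V => Gr V /\ fV_is V f.
Definition Pi (f : int -> int) : 'M[K]_(k, n) -> Prop := zclosure (cell f).

(* Basic positroid variety X_{S <= r}, S = {alpha+1, ..., alpha+m} mod n *)
Definition Xbasic (alpha m r : nat) : 'M[K]_(k, n) -> Prop :=
  fun V => Gr V /\
    (\rank (\sum_(s < m) <<colv V (alpha + s.+1)%:Z>>)%MS <= r)%N.

Definition is_basic (P : 'M[K]_(k, n) -> Prop) : Prop :=
  exists alpha m r : nat, (0 < m <= n)%N /\
    forall V, P V <-> Xbasic alpha m r V.

Definition Jf (f : int -> int) : {mpoly K[N]} -> Prop :=
  fun p => forall V, Pi f V -> meval (plucker V) p = 0.

Definition lin_ext (rk : KSub -> nat) : Prop :=
  injective rk /\ forall a b, pleq a b -> (rk a <= rk b)%N.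

Definition grevlex_gt (rk : KSub -> nat) (m1 m2 : 'X_{1..N}) : Prop :=
  (mdeg m2 < mdeg m1)%N \/
  (mdeg m1 = mdeg m2 /\
   exists v : 'I_N, (m1 v < m2 v)%N /\
     forall w : 'I_N, (rk (enum_val w) < rk (enum_val v))%N -> m1 w = m2 w).

Definition is_lead (rk : KSub -> nat) (p : {mpoly K[N]}) (m : 'X_{1..N}) : Prop :=
  m \in msupp p /\
  forall m', m' \in msupp p -> m' != m -> grevlex_gt rk m m'.

Definition in_initial (rk : KSub -> nat) (J : {mpoly K[N]} -> Prop)
    (x : {mpoly K[N]}) : Prop :=
  exists (l : nat) (q g : 'I_l -> {mpoly K[N]}),
    (forall t, exists p m, [/\ J p, is_lead rk p m & g t = 'X_[m]]) /\
    x = \sum_(t < l) q t * g t.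

(* semistandard k x d tableaux: columns are k-subsets (strictly increasing
   columns), rows weakly increasing, i.e. columns weakly increase in the
   Pluecker poset. *)
Definition ssyt (d : nat) (T : 'I_d -> KSub) : Prop :=
  forall i j : 'I_d, (i <= j)%N -> pleq (T i) (T j).

Definition tab_monomial (d : nat) (T : 'I_d -> KSub) : {mpoly K[N]} :=
  \prod_(i < d) 'X_(enum_rank (T i)).

Definition Bf (rk : KSub -> nat) (f : int -> int) (d : nat) (T : 'I_d -> KSub) : Prop :=
  ssyt T /\ ~ in_initial rk (Jf f) (tab_monomial T).

End Grass.

(* Main.v *)
Require Import Defs.
From HB Require Import structures.
From mathcomp Require Import all_boot all_order all_algebra.
From mathcomp Require Import mpoly.
From mathcomp Require Import zify fingroup perm.
Import Order.TTheory GRing.Theory Num.Theory.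
Local Open Scope ring_scope.
Set Implicit Arguments. Unset Strict Implicit. Unset Printing Implicit Defensive.

(** Only one inclusion needs work: if a standard monomial [T], a chain
    [a_1 <= ... <= a_d] of column sets, is the leading monomial of some [p] vanishing on
    [Pi_f], then it is already the leading monomial of a polynomial vanishing on one of the
    basic varieties. To each [T] we attach a point [V] with [p(V) <> 0] whose cyclic
    interval ranks are as small as [T] allows.

    The point is built from the coordinate subspace of [a_d] by moving the leftmost pivots
    from [a_d] to [a_{d-1}], ..., to [a_1]. A move adds to the columns [j..i-1] combinations of
    later columns up to [i]; at a well chosen pair [(j, i)] it raises only ranks of intervals
    that still have room in the bound given by the columns of [T]. When the pivots are [a_1],
    every monomial not divisible by [[a_1]] and smaller than [T] vanishes at [V], so [[a_1]]
    can be factored out of [p], and the induction on [d] applies to the quotient: a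
    polynomial that is nonzero at a point stays nonzero under a generic perturbation.

    If the rank of [V] on a cyclic interval [S] exceeds [r], the bound yields disjoint
    blocks [B_c], of total size more than [r], of entries of the columns [a_c] in [S], lying
    further left as [c] grows. Antisymmetrising the monomial [T] over the permutations of
    the union of the blocks gives a polynomial that vanishes wherever the columns in [S] have
    rank at most [r]; every permutation moving a block makes the first moved column
    smaller, so [T] is the leading monomial. An interval that wraps around [n] is replaced by
    its complement, and the columns of [T] by theirs, in the dual Grassmannian. *)

(* [lia] after clearing every hypothesis that is not a bare comparison of naturals. *)
Ltac nlia :=
  repeat match goal with
  | H : ?T |- _ => lazymatch T with
    | is_true (leq _ _) => fail
    | is_true (andb (leq _ _) (leq _ _)) => fail
    | is_true (negb (leq _ _)) => fail
    | is_true (orb (leq _ _) (leq _ _)) => fail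
    | is_true (negb (orb (leq _ _) (leq _ _))) => fail
    | is_true (negb (andb (leq _ _) (leq _ _))) => fail
    | @eq bool (andb (leq _ _) (leq _ _)) _ => fail
    | is_true (negb (@eq_op _ _ _)) => fail
    | @eq nat _ _ => fail
    | nat => fail
    | _ => clear H
    end
  end; lia.

(** * Interval ranks of periodic sequences *)

(* The columns of a matrix are read as an [n]-periodic sequence [v]; [[n, 2n)] is the home
   window, and an interval whose left end is below [n] wraps around. *)
Section Spans.
Variables (K : fieldType) (k : nat).
Implicit Types (A : pred nat) (v : nat -> 'rV[K]_k).

Definition ispan v (a b : nat) : 'M[K]_k := (\sum_(z < b | (a <= z)%N) <<v z>>)%MS.
Definition irk v a b := \rank (ispan v a b).
Definition dep v a z : bool := (v z <= ispan v a z)%MS.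

Lemma mem_ispan v a b z : (a <= z)%N -> (z < b)%N -> (v z <= ispan v a b)%MS.
Proof.
move=> az zb; rewrite /ispan (sumsmx_sup (Ordinal zb)) //=.
by rewrite genmxE.
Qed.

Lemma ispan_sub v a b m (B : 'M[K]_(m, k)) :
  (forall z, (a <= z)%N -> (z < b)%N -> (v z <= B)%MS) -> (ispan v a b <= B)%MS.
Proof. by move=> h; apply/sumsmx_subP => z az; rewrite genmxE h. Qed.

Lemma ispan_mono v a b a' b' : (a' <= a)%N -> (b <= b')%N ->
  (ispan v a b <= ispan v a' b')%MS.
Proof. by move=> ha hb; apply: ispan_sub => z h1 h2; apply: mem_ispan; lia. Qed.

Lemma irk_dep v a b : (a <= b)%N -> irk v a b.+1 = (irk v a b + ~~ dep v a b)%N.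
Proof.
move=> ab; rewrite /irk.
have e : (ispan v a b.+1 :=: ispan v a b + v b)%MS.
  apply/eqmxP/andP; split.
    apply: ispan_sub => z az zb; have [->|ne] := eqVneq z b; first exact: addsmxSr.
    apply: submx_trans (addsmxSl _ _); apply: mem_ispan; lia.
  rewrite addsmx_sub ispan_mono //=; apply: mem_ispan; lia.
rewrite e; case: (boolP (dep v a b)) => h.
  by rewrite addn0 (addsmx_idPl h).
apply/eqP; rewrite eqn_leq; apply/andP; split.
  apply: leq_trans (mxrank_adds_leqif _ _) _.
  by rewrite leq_add2l rank_leq_row.
rewrite addn1; apply: rank_ltmx; rewrite ltmxE addsmxSl /=.
by apply: contra h => h; apply: submx_trans h; exact: addsmxSr.
Qed.

Lemma dep_mono v a a' z : (a' <= a)%N -> dep v a z -> dep v a' z.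
Proof. by move=> h; rewrite /dep => h'; apply: submx_trans h' (ispan_mono _ h _). Qed.

Lemma irk_sum v a b c : (a <= b)%N -> (b <= c)%N ->
  irk v a c = (irk v a b + \sum_(b <= z < c) ~~ dep v a z)%N.
Proof.
move=> ab; elim: c => [|c IH] bc.
  by rewrite big_geq // addn0; congr irk; lia.
have [e|lt] := eqVneq b c.+1; first by rewrite -e big_geq // addn0.
have bc' : (b <= c)%N by lia.
by rewrite irk_dep; [rewrite IH // big_nat_recr //= addnA | lia].
Qed.

(** Dependence on a shorter interval persists on a longer one, so moving the left end further left
    can only reduce the rank gained on [[b, c)]. *)
Lemma irk_diff_mono v a a' b c : (a' <= a)%N -> (a <= b)%N -> (b <= c)%N ->
  (irk v a' c + irk v a b <= irk v a' b + irk v a c)%N.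
Proof.
move=> h ab bc; rewrite (irk_sum v ab bc) (@irk_sum v a' b c) //; last by lia.
suff : (\sum_(b <= z < c) ~~ dep v a' z <= \sum_(b <= z < c) ~~ dep v a z)%N by lia.
by apply: leq_sum => z _; case: (boolP (dep v a z)) => [/(dep_mono h) ->|_] //; exact: leq_b1.
Qed.

Lemma irk0 v a b : (b <= a)%N -> irk v a b = 0%N.
Proof.
move=> h; apply/eqP; rewrite mxrank_eq0 -submx0; apply: ispan_sub => z; lia.
Qed.

(** For the columns of a matrix and [z >= n], this is the value at [z] of the inverse of the bounded
    affine permutation [f_V]. *)
Definition lastdep v z : nat := \max_(a < z.+1 | dep v a z) a.

Lemma lastdepP n v z : (forall z, v (z + n)%N = v z) -> (0 < n)%N -> (n <= z)%N ->
  [/\ (z - n <= lastdep v z)%N, (lastdep v z <= z)%N &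
      forall a, (a <= z)%N -> dep v a z = (a <= lastdep v z)%N].
Proof.
move=> pv n0 nz.
have d0 : dep v (z - n) z.
  rewrite /dep -{1}(subnK nz) pv; apply: mem_ispan; lia.
have lt0 : (z - n < z.+1)%N by lia.
have [a da ea] : {a : 'I_z.+1 | dep v a z & lastdep v z = a}.
  rewrite /lastdep.
  by have [a da ea] := @eq_bigmax_cond _ [pred a : 'I_z.+1 | dep v a z] (fun a => nat_of_ord a)
     (introT card_gt0P (ex_intro _ (Ordinal lt0) d0)); exists a.
split.
- exact: (@leq_bigmax_cond _ (fun a : 'I_z.+1 => dep v a z) (fun a => nat_of_ord a) (Ordinal lt0)).
- by rewrite ea -ltnS.
move=> b bz; apply/idP/idP => h.
  have lt : (b < z.+1)%N by lia.
  exact: (@leq_bigmax_cond _ (fun a : 'I_z.+1 => dep v a z) (fun a => nat_of_ord a) (Ordinal lt)).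
by apply: (dep_mono h); rewrite ea.
Qed.

Definition cnt A b c : nat := \sum_(b <= z < c) A z.

Lemma cnt_cat A a b c : (a <= b)%N -> (b <= c)%N -> cnt A a c = (cnt A a b + cnt A b c)%N.
Proof. by move=> *; rewrite /cnt (big_cat_nat _ (n := b)). Qed.

Lemma cnt_recr A b c : (b <= c)%N -> cnt A b c.+1 = (cnt A b c + A c)%N.
Proof. by move=> *; rewrite /cnt big_nat_recr. Qed.

Lemma cnt_recl A b c : (b < c)%N -> cnt A b c = (A b + cnt A b.+1 c)%N.
Proof. by move=> *; rewrite /cnt big_ltn. Qed.

Lemma cnt_geq A b c : (c <= b)%N -> cnt A b c = 0%N.
Proof. by move=> *; rewrite /cnt big_geq. Qed.

(* There is room below the rank bound set by a column [A] of the tableau: this bound is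
   [max_g (irk v a g + cnt A g b)] on intervals inside the window and
   [max_g (irk v a g - cnt A b g)] on wrapping ones. *)
Definition slackN A v a b : bool :=
  [exists g : 'I_b.+1, (a <= g)%N && (irk v a b < irk v a g + cnt A g b)%N].
Definition slackW n A v a b : bool :=
  [exists g : 'I_(a + n).+1, (b <= g)%N && (irk v a b + cnt A b g < irk v a g)%N].

Lemma slackNP A v a b : reflect
  (exists g, [/\ (a <= g)%N, (g <= b)%N & (irk v a b < irk v a g + cnt A g b)%N])
  (slackN A v a b).
Proof.
apply: (iffP existsP) => [[g /andP[h1 h2]]|[g [h1 h2 h3]]].
  by exists g; split => //; rewrite -ltnS.
by rewrite -ltnS in h2; exists (Ordinal h2); rewrite h1.
Qed.

Lemma slackWP n A v a b : reflect
  (exists g, [/\ (b <= g)%N, (g <= a + n)%N & (irk v a b + cnt A b g < irk v a g)%N])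
  (slackW n A v a b).
Proof.
apply: (iffP existsP) => [[g /andP[h1 h2]]|[g [h1 h2 h3]]].
  by exists g; split => //; rewrite -ltnS.
by rewrite -ltnS in h2; exists (Ordinal h2); rewrite h1.
Qed.

Lemma slackN_mono A v a a' b : (a' <= a)%N -> slackN A v a b -> slackN A v a' b.
Proof.
move=> h /slackNP [g [ag gb hg]]; apply/slackNP; exists g; split=> //; first lia.
by have := irk_diff_mono v h ag gb; lia.
Qed.

Lemma slackW_mono n A v a a' b : (a' <= a)%N -> (a <= b)%N ->
  slackW n A v a' b -> slackW n A v a b.
Proof.
move=> h ab /slackWP [g [ag gb hg]]; apply/slackWP; exists g; split=> //; first lia.
by have := irk_diff_mono v h ab ag; lia.
Qed.

(** Passing [b] raises the bound by [A b] and the rank by [~~ dep v a b], so slack is lost only at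
    an independent [b] outside [A]. *)
Lemma slackN_keep A v a b : (a <= b)%N -> A b || dep v a b ->
  slackN A v a b -> slackN A v a b.+1.
Proof.
move=> ab hA /slackNP [g [ag gb hg]]; apply/slackNP; exists g; split=> //; first lia.
by move: hA; rewrite irk_dep // cnt_recr //; case: (A b); case: dep => //=; lia.
Qed.

Lemma slackN_start A v a b : (a <= b)%N -> A b -> dep v a b -> slackN A v a b.+1.
Proof.
move=> ab hA hd; apply/slackNP; exists b; split=> //.
by rewrite irk_dep // hd /= cnt_recr // hA cnt_geq //; lia.
Qed.

(** For wrapping intervals slack travels leftwards and is lost only at a dependent [b] inside
    [A]. *)
Lemma slackW_keep n A v a b : (a <= b)%N -> ~~ A b || ~~ dep v a b ->
  slackW n A v a b.+1 -> slackW n A v a b.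
Proof.
move=> ab hA /slackWP [g [ag gb hg]]; apply/slackWP; exists g; split=> //; first lia.
move: hA hg; rewrite irk_dep // (@cnt_recl A b g) //.
by case: (A b); case: dep => //=; lia.
Qed.

Lemma slackW_start n A v a b : (a <= b)%N -> (b < a + n)%N -> ~~ A b -> ~~ dep v a b ->
  slackW n A v a b.
Proof.
move=> ab hb hA hd; apply/slackWP; exists b.+1; split=> //.
by rewrite irk_dep // hd /= cnt_recr // (negbTE hA) cnt_geq //; lia.
Qed.

Lemma closest_pair (P Q : pred nat) j0 i0 : (j0 < i0)%N -> P j0 -> Q i0 ->
  (forall z, ~~ (P z && Q z)) ->
  exists j i, [/\ (j0 <= j)%N, (j < i)%N, (i <= i0)%N, P j & Q i] /\
    forall z, (j < z < i)%N -> ~~ P z && ~~ Q z.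
Proof.
move=> lt Pj Qi PQ.
have exi : exists i, (j0 < i)%N && Q i by exists i0; rewrite lt.
case: (ex_minnP exi) => i /andP[ji Qi'] mini.
have exj : exists j, (j < i)%N && P j by exists j0; rewrite ji.
have bj : forall j, (j < i)%N && P j -> (j <= i)%N by move=> j /andP[/ltnW].
case: (ex_maxnP exj bj) => j /andP[ji' Pj'] maxj.
have j0j : (j0 <= j)%N by apply: maxj; rewrite ji.
exists j, i; split; first by split=> //; apply: mini; rewrite lt.
move=> z /andP[jz zi]; apply/andP; split; apply/negP => h.
  by have := maxj z; rewrite zi h /= => /(_ isT); nlia.
by have := mini z; rewrite h andbT; move=> /(_ ltac:(nlia)); nlia.
Qed.

(* Start from a closest pair with [j] in [A] but not a pivot and [i] a pivot outside [A], so
   that [A] and the pivots agree in between; then take the last admissible [j] and the first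
   admissible [i]: a failure of the slack in between would yield a later [j] or an
   earlier [i]. *)
Lemma bridge_exists n v A j0 i0 :
  (forall z, v (z + n)%N = v z) -> (0 < n)%N ->
  (n <= j0)%N -> (j0 < i0)%N -> (i0 < n + n)%N ->
  A j0 -> dep v n j0 -> ~~ A i0 -> ~~ dep v n i0 ->
  exists j i, [/\ (n <= j)%N, (j < i)%N, (i < n + n)%N, dep v n j & ~~ dep v n i]
   /\ forall b, (j < b <= i)%N ->
      slackN A v (lastdep v j) b /\ slackW n A v (lastdep v i).+1 b.
Proof.
move=> pv n0 nj0 lt0 i0n Aj0 dj0 Ai0 di0.
have disj z : ~~ ((A z && dep v n z) && (~~ A z && ~~ dep v n z)) by case: (A z); rewrite /= ?andbF.
have [j1 [i1 [[h1 h2 h3 /andP[Aj1 dj1] /andP[Ai1 di1]] hb]]] :=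
  @closest_pair (fun z => A z && dep v n z) (fun z => ~~ A z && ~~ dep v n z) j0 i0
   lt0 (introT andP (conj Aj0 dj0)) (introT andP (conj Ai0 di0))
   disj.
have gP z : (n <= z)%N -> _ := @lastdepP n v z pv n0.
have exj : exists j, [&& (j1 <= j)%N, (j < i1)%N, dep v n j & slackN A v (lastdep v j) j.+1].
  exists j1; rewrite leqnn h2 dj1 /=; have [|_ g2 g3] := gP j1; first nlia.
  by apply: slackN_start => //; rewrite g3.
have bj : forall j, [&& (j1 <= j)%N, (j < i1)%N, dep v n j & slackN A v (lastdep v j) j.+1]
   -> (j <= i1)%N by move=> j /and4P[_ /ltnW].
case: (ex_maxnP exj bj) => j /and4P[j1j ji1 dj sj] maxj.
have nj : (n <= j)%N by nlia.
have [_ gj2 gj3] := gP j nj.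
have SN b : (j < b <= i1)%N -> slackN A v (lastdep v j) b.
  elim: b => [|b IH]; first nlia.
  move=> /andP[jb bi1]; have [->//|ne] := eqVneq b j.
  have sb : slackN A v (lastdep v j) b by apply: IH; nlia.
  case: (boolP (A b || dep v (lastdep v j) b)) => h; first by apply: slackN_keep => //; nlia.
  (* Here [b] is outside [A], hence no pivot, and [lastdep v b < lastdep v j]; then [b] inherits the
     slack and is admissible, against the maximality of [j]. *)
  move: h; rewrite negb_or => /andP[nA nd].
  have nb : (n <= b)%N by nlia.
  have [_ gb2 gb3] := gP b nb.
  have dn : dep v n b.
    by have := hb b ltac:(nlia); rewrite nA /= negbK => /andP[].
  have lt : (lastdep v b < lastdep v j)%N by move: nd; rewrite gb3; nlia.
  have := maxj b; rewrite dn; have -> : (j1 <= b)%N by nlia.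
  have -> : (b < i1)%N by nlia.
  move=> /= h; exfalso.
  suff : (b <= j)%N by nlia.
  apply: h; apply: slackN_keep => //; first by rewrite (gb3 _ gb2) leqnn orbT.
  by apply: slackN_mono sb; exact: ltnW.
have exi : exists i, [&& (j < i)%N, (i <= i1)%N, ~~ dep v n i & slackW n A v (lastdep v i).+1 i].
  exists i1; rewrite ji1 leqnn di1 /=; have [|g1 g2 g3] := gP i1; first nlia.
  have gn : (lastdep v i1 < n)%N by move: di1; rewrite g3; nlia.
  by apply: slackW_start => //; [nlia|nlia|rewrite g3; nlia].
case: (ex_minnP exi) => i /and4P[ji ii1 di si] mini.
have ni : (n <= i)%N by nlia.
have [gi1 gi2 gi3] := gP i ni.
have gin : (lastdep v i < n)%N by move: di; rewrite gi3; nlia.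
exists j, i; split; first by split => //; nlia.
move=> b hbji; split; first by apply: SN; nlia.
have [e eb0] : exists e, b = (i - e)%N by exists (i - b)%N; nlia.
move: hbji; rewrite eb0 => hbji {b eb0}.
have : (j < i - e)%N by nlia.
elim: e {hbji} => [|e IH] hje; first by rewrite subn0.
have [lt|ge] := ltnP e i; last by move: hje; nlia.
have {}IH := IH ltac:(nlia).
set b := (i - e.+1)%N in hje *.
have eb : (i - e = b.+1)%N by rewrite /b; nlia.
rewrite eb in IH.
have nb : (n <= b)%N by nlia.
have [_ gb2 gb3] := gP b nb.
case: (boolP (~~ A b || ~~ dep v (lastdep v i).+1 b)) => h.
  by apply: slackW_keep => //; nlia.
(* Symmetrically, [b] lies in [A], hence is a pivot, and [lastdep v i < lastdep v b], so that [b]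
   would be an earlier choice of [i]. *)
move: h; rewrite negb_or !negbK => /andP[Ab db].
have bi : (b < i)%N by rewrite /b; nlia.
have dn : ~~ dep v n b.
  by have := hb b ltac:(nlia); rewrite Ab /= andbT.
exfalso; have := mini b; rewrite dn.
have -> : (j < b)%N by nlia.
have -> : (b <= i1)%N by nlia.
move=> /= h; suff : (i <= b)%N by nlia.
apply: h.
have gbn : (lastdep v b < n)%N by move: dn; rewrite gb3; nlia.
have gib : (lastdep v i < lastdep v b)%N by move: db; rewrite gb3 //; nlia.
apply: slackW_keep; first nlia.
  by rewrite gb3; [rewrite ltnn orbT | nlia].
by apply: slackW_mono IH; nlia.
Qed.

End Spans.

(** * Moving pivots *)

Section Bridge.
Variables (K : fieldType) (k : nat).
Implicit Types (A : pred nat) (v : nat -> 'rV[K]_k).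

Lemma submx_exchange m (x y : 'rV[K]_k) (W : 'M[K]_(m, k)) :
  (x <= W + y)%MS -> ~~ (x <= W)%MS -> (y <= W + x)%MS.
Proof.
move=> /sub_addsmxP[[a c] /= e] nx.
rewrite (mx11_scalar c) mul_scalar_mx in e.
have c0 : c 0 0 != 0.
  apply: contra nx => /eqP c0; rewrite e c0 scale0r addr0.
  exact: submxMl.
have -> : y = (c 0 0)^-1 *: x - (c 0 0)^-1 *: (a *m W).
  by rewrite e scalerDr scalerA mulVf // scale1r addrAC subrr add0r.
rewrite addmx_sub //; first by rewrite scalemx_sub // addsmxSr.
by rewrite -scaleNr scalemx_sub // (submx_trans (submxMl _ _)) // addsmxSl.
Qed.

Lemma separating_functional m (x : 'rV[K]_k) (W : 'M[K]_(m, k)) :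
  ~~ (x <= W)%MS -> exists phi : 'cV[K]_k, W *m phi = 0 /\ (x *m phi) 0 0 = 1.
Proof.
rewrite submxE; have := mulmx_coker W; move: (cokermx W) => C WC /rV0Pn[j hj].
exists (((x *m C) 0 j)^-1 *: col j C); split.
  by rewrite -scalemxAr colE (mulmxA W) WC mul0mx scaler0.
by rewrite -scalemxAr mxE colE (mulmxA x) -colE [col _ _ _ _]mxE mulVf.
Qed.

(** Otherwise the first later pivot whose addition captures [v j] could be exchanged with [v j], and
    would depend on earlier window vectors. *)
Lemma pivots_free v n b j a : (n < a)%N -> (n <= j < b)%N ->
  ~~ dep v a j ->
  ~~ (v j <= ispan v a j + \sum_(m < b | (j < m)%N && ~~ dep v n m) <<v m>>)%MS.
Proof.
move=> na /andP[nj]; elim: b => [|b IH] jb dj; first lia.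
have [e|ne] := eqVneq j b.
  subst b; rewrite [X in (_ + X)%MS]big1 ?addsmx0 // => m /andP[jm _].
  by have := ltn_ord m; lia.
have {}IH := IH ltac:(lia) dj.
rewrite [X in (_ + X)%MS]big_mkcond big_ord_recr -big_mkcond /=.
case: ifP => [/andP[_ db]|_]; last first.
  by apply: contra IH => h; apply: submx_trans h _; apply: addsmxS => //; rewrite addsmx0.
apply/negP => h; move: db; rewrite /dep => /negP; apply.
have {}h : (v j <= (ispan v a j + \sum_(m < b | (j < m)%N && ~~ dep v n m) <<v m>>) + v b)%MS.
  apply: submx_trans h _; rewrite addsmxA; apply: addsmxS => //.
  by rewrite genmxE.
apply: submx_trans (submx_exchange h IH) _.
rewrite !addsmx_sub mem_ispan; [|lia|lia]; rewrite andbT.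
apply/andP; split; first by apply: ispan_mono; lia.
apply/sumsmx_subP => m /andP[jm _]; rewrite genmxE mem_ispan //; lia.
Qed.

(* The perturbation adds to [v z], for [j <= z < i], a multiple [c z] of [w z], where [w z] is
   [v i] minus its components along the pivots strictly between [z] and [i]. In particular
   [w j] lies in the span of [v (lastdep v i) .. v j]. The multiple [c z] is [1] at [j] and elsewhere the value
   at [v z] of a functional [phi] killing the pivots and [v z] for [lastdep v j < z < j], so
   that intervals starting after [lastdep v j] only undergo a shear. *)
Lemma bridge n v j i :
  (forall z, v (z + n)%N = v z) -> (0 < n)%N ->
  (n <= j)%N -> (j < i)%N -> (i < n + n)%N -> dep v n j -> ~~ dep v n i ->
  exists u : nat -> 'rV[K]_k, (forall z, u (z + n)%N = u z) /\
  forall t, t != 0 -> let v' := fun z => v z + t *: u z in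
  [/\ forall a b, (n <= b <= n + n)%N -> (a <= b <= a + n)%N ->
        (irk v' a b <= irk v a b +
          ((j < b <= i) && (lastdep v i < a <= lastdep v j)))%N,
      forall b, (n <= b <= n + n)%N -> (irk v n b <= irk v' n b)%N
    & (irk v n j.+1 < irk v' n j.+1)%N].
Proof.
move=> pv n0 nj ji i2n dj di.
have [|gi1 gi2 giP] := @lastdepP _ _ n v i pv n0; first lia.
have [//|gj1 gj2 gjP] := @lastdepP _ _ n v j pv n0.
set gi := lastdep v i in gi1 gi2 giP *; set gj := lastdep v j in gj1 gj2 gjP *.
have gin : (gi < n)%N by move: di; rewrite giP; lia.
have ngj : (n <= gj)%N by rewrite -gjP.
pose S := (\sum_(m < i | (j < m)%N && ~~ dep v n m) <<v m>>)%MS.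
(* Non-pivots after [j] depend on earlier window vectors, and the window starts after [gi];
   eliminating them leaves the vectors up to [j] and pivots. *)
have hvi : (v i <= ispan v gi j.+1 + S)%MS.
  have h z : (gi <= z)%N -> (z < i)%N -> (v z <= ispan v gi j.+1 + S)%MS.
    elim/ltn_ind: z => z IH gz zi; case: (leqP z j) => zj.
      by apply: submx_trans (addsmxSl _ _); apply: mem_ispan; nlia.
    case: (boolP (dep v n z)) => [dz|nd].
      apply: submx_trans dz _; apply: ispan_sub => y ny yz; apply: IH; nlia.
    apply: submx_trans (addsmxSr _ _).
    by rewrite /S (sumsmx_sup (Ordinal zi)) ?genmxE //= zj.
  have : dep v gi i by rewrite giP.
  by move=> hd; apply: submx_trans hd _; apply: ispan_sub.
have {hvi} [[u0 s] /= evi] := sub_addsmxP hvi.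
have [x ex] := sub_sumsmxP (submxMl s S : (s *m S <= S)%MS).
pose y (m : 'I_i) := x m *m <<v m>>%MS.
pose w (c : nat) := v i - \sum_(m < i | ((j < m)%N && ~~ dep v n m) && (c < m)%N) y m.
have ysub (m : 'I_i) m' (B : 'M_(m', k)) : (v m <= B)%MS -> (y m <= B)%MS.
  by move=> h; apply: submx_trans (submxMl _ _) _; rewrite genmxE.
(* Only three facts about [w] are used below: [v i - w c] involves pivots after [c], two values of
   [w] differ by the pivots in between, and [w j] lies in the span of [v gi .. v j]. *)
have w_vi m' (B : 'M_(m', k)) c :
    (forall m, (c < m)%N -> (m < i)%N -> (j < m)%N -> ~~ dep v n m -> (v m <= B)%MS) ->
    (v i - w c <= B)%MS.
  move=> h; rewrite /w opprD addrA subrr add0r opprK summx_sub // => m /andP[/andP[h1 h2] h3].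
  by apply: ysub; apply: h.
have w_diff m' (B : 'M_(m', k)) c c' : (c <= c')%N ->
    (forall m, (c < m <= c')%N -> (m < i)%N -> (j < m)%N -> ~~ dep v n m -> (v m <= B)%MS) ->
    (w c' - w c <= B)%MS.
  move=> cc h; rewrite /w opprD addrACA subrr add0r opprK addrC.
  rewrite [X in X - _](bigID (fun m : 'I_i => (c' < m)%N)) /=.
  rewrite [X in X + _ - _](eq_bigl
     (fun m : 'I_i => ((j < m)%N && ~~ dep v n m) && (c' < m)%N)); last first.
    move=> m; rewrite -!andbA; congr [&& _, _ & _].
    by case: (ltnP c' m) => h'; rewrite ?andbF ?andbT //; nlia.
  rewrite addrAC subrr add0r summx_sub // => m /andP[/andP[/andP[h1 h2] h3] h4].
  by apply: ysub; apply: h => //; nlia.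
have w_j m' (B : 'M_(m', k)) : (ispan v gi j.+1 <= B)%MS -> (w j <= B)%MS.
  move=> h; rewrite /w [X in X - _]evi ex.
  rewrite [X in _ - X](eq_bigl (fun m : 'I_i => (j < m)%N && ~~ dep v n m)); last first.
    by move=> m; case: ltnP => //=; rewrite ?andbT ?andbF.
  by rewrite addrK (submx_trans (submxMl _ _)).
clearbody w; clear y ysub ex x.
have [phi [phiJ phij phi1]] : exists phi : 'cV[K]_k,
   [/\ forall m, (j < m < i)%N -> ~~ dep v n m -> v m *m phi = 0,
       forall z, (gj < z < j)%N -> v z *m phi = 0
     & (gj < j)%N -> (v j *m phi) 0 0 = 1].
  have [lt|ge] := ltnP gj j; last first.
    by exists 0; split=> // *; rewrite mulmx0.
  have nd : ~~ dep v gj.+1 j by rewrite gjP // -leqNgt.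
  have h := @pivots_free v n i j gj.+1 _ _ nd.
  have [||phi [e1 e2]] := separating_functional (h _ _); [nlia|nlia|].
  have sub0 (r : 'rV[K]_k) : (r <= ispan v gj.+1 j + S)%MS -> r *m phi = 0.
    by case/submxP => D ->; rewrite -mulmxA e1 mulmx0.
  exists phi; split=> // [m /andP[jm mi] dm|z /andP[gz zj]]; apply: sub0.
    apply: submx_trans (addsmxSr _ _).
    by rewrite /S (sumsmx_sup (Ordinal mi)) ?genmxE //= jm.
  by apply: submx_trans (addsmxSl _ _); apply: mem_ispan.
pose c (z : nat) := if z == j then 1 else (v z *m phi) 0 0.
(* [n + z %% n] is the representative of [z] in the home window, which makes [u] periodic. *)
pose u (z : nat) := let z' := (n + z %% n)%N in if (j <= z' < i)%N then c z' *: w z' else 0.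
have resz (z : nat) : (z < n + n)%N -> ((n + z %% n = z) /\ (n <= z)%N \/ (n + z %% n = z + n)%N /\ (z < n)%N)%N.
  move=> zz; have [zn|zn] := ltnP z n; first by right; rewrite modn_small // addnC.
  left; split=> //; rewrite -{2}(subnKC zn) -{1}(subnKC zn) modnDl modn_small //; lia.
have cJ m : (j < m < i)%N -> ~~ dep v n m -> c m = 0.
  move=> h dm; rewrite /c ifN; last by nlia.
  by rewrite phiJ // mxE.
have uid (z : nat) : (n <= z < n + n)%N -> u z = if (j <= z < i)%N then c z *: w z else 0.
  by move=> h; rewrite /u; have [|[-> _]|[_]] := resz z => //; nlia.
exists u; split; first by move=> z; rewrite /u modnDr.
move=> t t0; set v' := fun z => v z + t *: u z.
have vJ m : (j < m < i)%N -> ~~ dep v n m -> v' m = v m.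
  move=> h dm; rewrite /v' uid; last by nlia.
  by case: ifP => _; rewrite ?cJ // ?scale0r ?scaler0 addr0.
have vout (z : nat) : (n <= z < n + n)%N -> ~~ (j <= z < i)%N -> v' z = v z.
  by move=> h h'; rewrite /v' uid // ifN // scaler0 addr0.
have wj_v' : w j = t^-1 *: (v' j - v j).
  rewrite /v' uid; last by nlia.
  rewrite leqnn ji /c eqxx scale1r addrAC subrr add0r scalerA mulVf //.
  by rewrite scale1r.
(* If the interval contains [i], or if [z] is in its wrapped part, then [v i] and all pivots used in
   [w z] occur in it, possibly shifted by [n]. *)
have full_i a b z : (a <= z < b)%N -> (n <= b <= n + n)%N ->
    (i < b)%N || (z < n)%N -> (v' z <= ispan v a b)%MS.
  move=> zab bn ib; rewrite /v' addmx_sub //; first by apply: mem_ispan; nlia.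
  rewrite /u; case: ifP => [h|_]; last by rewrite scaler0 sub0mx.
  rewrite !scalemx_sub //.
  have mem m : (n + z %% n < m <= i)%N -> (v m <= ispan v a b)%MS.
    move=> hm; have [|[e zn]|[e zn]] := resz z; first by nlia.
      apply: mem_ispan; nlia.
    have -> : v m = v (m - n)%N by rewrite -[in LHS](@subnK n m) ?pv //; nlia.
    apply: mem_ispan; nlia.
  rewrite -[w _](subKr (v i)) addmx_sub ?mem ?eqmx_opp //; first by nlia.
  by apply: w_vi => m h1 h2 h3 h4; apply: mem; nlia.
split.
- move=> a b bn ab.
  have [hji|nji] := boolP (j < b <= i)%N; last first.
    rewrite addn0; apply/mxrankS/ispan_sub => z az zb.
    case: (boolP ((i < b) || (z < n))%N) => h; first by apply: full_i => //; nlia.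
    by rewrite vout ?mem_ispan //; move: h nji; nlia.
  (* For [a <= gi] the interval contains [v gi .. v j], hence its span contains [w j]; the later
     [w z] differ from it by pivots of the interval. *)
  have [agi|gia] := leqP a gi.
    rewrite addn0; apply/mxrankS/ispan_sub => z az zb.
    case: (ltnP z n) => zn; first by apply: full_i; rewrite ?zn ?orbT //; nlia.
    have zw : (n <= z < n + n)%N by nlia.
    rewrite /v' addmx_sub ?mem_ispan // uid //; case: ifP => [h|_]; last by rewrite scaler0 sub0mx.
    rewrite !scalemx_sub // -[w z](subrK (w j)) addmx_sub //.
      apply: w_diff; first by nlia.
      by move=> m h1 h2 h3 h4; apply: mem_ispan; nlia.
    apply: w_j; apply: ispan_mono; nlia.
  (* For [a <= gj] the only new direction is [w j], so the rank rises by at most one. *)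
  have [agj|gja] := leqP a gj.
    apply: leq_trans (_ : \rank (ispan v a b + w j)%MS <= _)%N; last first.
      apply: leq_trans (mxrank_adds_leqif _ _) _.
      by rewrite leq_add2l rank_leq_row.
    apply/mxrankS/ispan_sub => z az zb.
    case: (ltnP z n) => zn.
      apply: submx_trans (addsmxSl _ _).
      by apply: full_i; rewrite ?zn ?orbT //; nlia.
    have zw : (n <= z < n + n)%N by nlia.
    rewrite /v' addmx_sub //.
      by apply: submx_trans (addsmxSl _ _); apply: mem_ispan.
    rewrite uid //; case: ifP => [h|_]; last by rewrite scaler0 sub0mx.
    rewrite !scalemx_sub // -[w z](subrK (w j)) addmx_sub ?addsmxSr //.
    apply: submx_trans (addsmxSl _ _).
    apply: w_diff; first by nlia.
    by move=> m h1 h2 h3 h4; apply: mem_ispan; nlia.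
  rewrite /= addn0.
  (* Beyond [gj] the perturbed vectors lie in the image of the old span under [M], which cannot
     raise the rank: [w z - w d] is a combination of pivots of the interval, and [M] fixes these
     because [phi] kills them. *)
  pose d := maxn j a.-1.
  pose M : 'M[K]_k := 1%:M + t *: (phi *m w d).
  apply: leq_trans (mxrankM_maxl (ispan v a b) M).
  have vM z : (a <= z < b)%N -> (v z *m M <= ispan v a b *m M)%MS.
    by move=> h; apply: submxMr; apply: mem_ispan; nlia.
  have vMe z : v z *m M = v z + (t * (v z *m phi) 0 0) *: w d.
    rewrite mulmxDr mulmx1 -scalemxAr mulmxA [X in X *m w d]mx11_scalar mul_scalar_mx.
    by rewrite scalerA.
  apply/mxrankS/ispan_sub => z az zb.
  have zw : (n <= z < n + n)%N by nlia.
  rewrite /v' uid //; case: ifP => [h|h].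
    have -> : v z + t *: (c z *: w z) = v z *m M + (t * c z) *: (w z - w d).
      rewrite vMe; have -> : (v z *m phi) 0 0 = c z.
        by rewrite /c; case: eqP => // e; rewrite e; apply: phi1; rewrite e in az; nlia.
      by rewrite scalerBr scalerA -addrA; congr (_ + _); rewrite addrC subrK.
    rewrite addmx_sub //; first by apply: vM; nlia.
    rewrite scalemx_sub //; apply: w_diff; first by rewrite /d; nlia.
    move=> m hm h2 h3 h4.
    have {1}-> : v m = v m *m M by rewrite vMe phiJ // ?mxE ?mulr0 ?scale0r ?addr0 //; nlia.
    by apply: vM; rewrite /d in hm; nlia.
  have zj : (z < j)%N by move: h; nlia.
  have {1}-> : v z = v z *m M by rewrite vMe phij ?mxE ?mulr0 ?scale0r ?addr0 //; nlia.
  by rewrite scaler0 addr0 vM //; nlia.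
- move=> b bn; apply/mxrankS/ispan_sub => z nz zb.
  have zw : (n <= z < n + n)%N by nlia.
  case: (boolP (j <= z < i)%N) => h; last by rewrite -vout // mem_ispan.
  have -> : v z = v' z - t *: (c z *: w z) by rewrite /v' uid // h addrK.
  rewrite addmx_sub ?mem_ispan // eqmx_opp !scalemx_sub //.
  have vJm m : (j < m < i)%N -> ~~ dep v n m -> (m < b)%N -> (v m <= ispan v' n b)%MS.
    by move=> h1 h2 h3; rewrite -vJ // mem_ispan //; nlia.
  have [ib|bi] := ltnP i b.
    rewrite -[w _](subKr (v i)) addmx_sub //.
      by rewrite -vout ?mem_ispan //; nlia.
    by rewrite eqmx_opp; apply: w_vi => m h1 h2 h3 h4; apply: vJm => //; nlia.
  rewrite -[w z](subrK (w j)) addmx_sub //.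
    apply: w_diff; first by nlia.
    by move=> m h1 h2 h3 h4; apply: vJm => //; nlia.
  (* [w j] is recovered from [v' j - v j], and [v j] depends on window vectors before [j], which are
     left unchanged. *)
  rewrite wj_v' scalemx_sub // addmx_sub //; first by apply: mem_ispan; nlia.
  rewrite eqmx_opp; apply: submx_trans dj _; apply: ispan_sub => x0 h1 h2.
  by rewrite -vout ?mem_ispan //; nlia.
apply: rank_ltmx; rewrite ltmxE; apply/andP; split.
  apply: ispan_sub => z nz zj; have [e|ne] := eqVneq z j.
    rewrite e; apply: submx_trans dj _; apply: ispan_sub => x0 h1 h2.
    by rewrite -vout ?mem_ispan //; nlia.
  by rewrite -vout ?mem_ispan //; nlia.
(* Equality of the spans would put [w j], hence [v i], in the span of the preceding window vectors,
   although [i] is a pivot. *)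
apply/negP => h; move/negP: di; apply; rewrite /dep.
rewrite -[v i](subrK (w j)) addmx_sub //.
  by apply: w_vi => m h1 h2 h3 h4; apply: mem_ispan; nlia.
apply: submx_trans (_ : ispan v n j.+1 <= _)%MS; last by apply: ispan_mono.
rewrite wj_v' scalemx_sub // addmx_sub ?eqmx_opp ?mem_ispan //.
by apply: submx_trans h; apply: mem_ispan.
Qed.

End Bridge.

(** * Iterated moves up to prescribed pivots *)

Section Dom.
Variables (K : fieldType) (k : nat).
Implicit Types (A : pred nat) (v : nat -> 'rV[K]_k).

(** The bound that one column [A] puts on the ranks. Allowing any threshold [g] makes it reflexive
    and transitive, so any number of moves costs a single column. *)
Definition dom n A v' v : Prop :=
  (forall a b, (n <= a <= b)%N -> (b <= n + n)%N -> exists g,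
     [/\ (a <= g)%N, (g <= b)%N & (irk v' a b <= irk v a g + cnt A g b)%N]) /\
  (forall a b, (a < n)%N -> (n <= b <= a + n)%N -> exists g,
     [/\ (b <= g)%N, (g <= a + n)%N & (irk v' a b + cnt A b g <= irk v a g)%N]).

Lemma dom_refl n A v : dom n A v v.
Proof.
split=> a b h1 h2; exists b; split; rewrite ?cnt_geq ?addn0 //; lia.
Qed.

Lemma dom_trans n A v1 v2 v3 : dom n A v1 v2 -> dom n A v2 v3 -> dom n A v1 v3.
Proof.
move=> [N1 W1] [N2 W2]; split=> a b h1 h2.
  have [g [ag gb hg]] := N1 a b h1 h2.
  have [||g' [ag' gb' hg']] := N2 a g; [lia|lia|].
  exists g'; split; [lia|lia|].
  by rewrite (@cnt_cat A g' g b) //; lia.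
have [g [ag gb hg]] := W1 a b h1 h2.
have [||g' [ag' gb' hg']] := W2 a g; [lia|lia|].
exists g'; split; [lia|lia|].
by rewrite (@cnt_cat A b g g') //; lia.
Qed.

(** Where the move raises a rank by one, [bridge_exists] provides slack that absorbs the increase;
    elsewhere the threshold [b] works. *)
Lemma dom_step n A v j0 i0 :
  (forall z, v (z + n)%N = v z) -> (0 < n)%N ->
  (n <= j0)%N -> (j0 < i0)%N -> (i0 < n + n)%N ->
  A j0 -> dep v n j0 -> ~~ A i0 -> ~~ dep v n i0 ->
  exists u : nat -> 'rV[K]_k, (forall z, u (z + n)%N = u z) /\
  forall t, t != 0 -> let v' := fun z => v z + t *: u z in
  [/\ dom n A v' v,
      forall b, (n <= b <= n + n)%N -> (irk v n b <= irk v' n b)%N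
    & exists2 b, (n <= b <= n + n)%N & (irk v n b < irk v' n b)%N].
Proof.
move=> pv n0 nj0 lt0 i0n Aj dj Ai di.
have [j [i [[nj ji i2n dj' di'] S]]] := bridge_exists pv n0 nj0 lt0 i0n Aj dj Ai di.
have [u [pu hu]] := bridge pv n0 nj ji i2n dj' di'.
exists u; split=> // t /hu /= [h1 h2 h3]; split=> //; last by exists j.+1 => //; lia.
split=> a b hab hb.
- have h := h1 a b ltac:(lia) ltac:(lia).
  case: (boolP ((j < b <= i) && (lastdep v i < a <= lastdep v j))%N) h => [/andP[jb /andP[_ aj]]|_] h.
    have [/(slackN_mono aj)/slackNP[g [ag gb hg]] _] := S b jb.
    by exists g; split=> //; lia.
  by exists b; split; rewrite ?cnt_geq //; lia.
- have h := h1 a b ltac:(lia) ltac:(lia).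
  case: (boolP ((j < b <= i) && (lastdep v i < a <= lastdep v j))%N) h => [/andP[jb /andP[ia _]]|_] h.
    have [_ sW] := S b jb.
    have /slackWP[g [ag gb hg]] : slackW n A v a b by apply: slackW_mono sW => //; lia.
    by exists g; split=> //; lia.
  by exists b; split; rewrite ?cnt_geq //; lia.
Qed.

(** Induction on the total deficit of the ranks [irk v n b] against the counts of [A], which each
    move lowers. [P] stands for the nonvanishing of a polynomial, which survives for a suitable
    nonzero [t]. *)
Lemma fill_pivots n A (P : (nat -> 'rV[K]_k) -> Prop) v :
  (0 < n)%N -> (forall z, v (z + n)%N = v z) ->
  (forall b, (n <= b <= n + n)%N -> (irk v n b <= cnt A n b)%N) ->
  irk v n (n + n) = cnt A n (n + n) ->
  P v ->
  (forall v u, (forall z, v (z + n)%N = v z) -> (forall z, u (z + n)%N = u z) -> P v ->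
     exists2 t, t != 0 & P (fun z => v z + t *: u z)) ->
  exists v', [/\ forall z, v' (z + n)%N = v' z, P v', dom n A v' v &
    forall b, (n <= b <= n + n)%N -> irk v' n b = cnt A n b].
Proof.
move=> n0 + + + + PS.
have [m] := ubnP (\sum_(n <= b < (n + n).+1) (cnt A n b - irk v n b))%N.
elim: m v => // m IH v; rewrite ltnS => hm pv le eqn Pv.
case: (boolP [exists b : 'I_n.+1, (irk v n (n + b) < cnt A n (n + b))%N]) => [/existsP[b hb]|]; last first.
  rewrite negb_exists => /forallP h; exists v; split=> //; first exact: dom_refl.
  move=> b hb; apply/eqP; rewrite eqn_leq le //=.
  have lb : (b - n < n.+1)%N by lia.
  by have := h (Ordinal lb); rewrite /= subnKC -?leqNgt //; lia.
have bn := ltn_ord b; set b0 := (n + b)%N in hb.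
have irkE c : (n <= c)%N -> irk v n c = (\sum_(n <= z < c) ~~ dep v n z)%N.
  by move=> nc; rewrite (@irk_sum _ _ v n n c) // irk0.
(* A deficit at [b0] forces a non-pivot in [A] before [b0]; as the totals agree, there is a pivot
   outside [A] from [b0] on. *)
have [j0 hj0] : exists j0, [&& (n <= j0)%N, (j0 < b0)%N, A j0 & dep v n j0].
  case: (boolP [exists z : 'I_b0, [&& (n <= z)%N, A z & dep v n z]]) => [/existsP[z /and3P[h1 h2 h3]]|].
    by exists z; rewrite h1 h2 h3 ltn_ord.
  rewrite negb_exists => /forallP h; exfalso.
  move: hb; rewrite irkE; last by rewrite /b0; lia.
  rewrite ltnNge => /negP; apply; rewrite /cnt big_seq [X in (_ <= X)%N]big_seq leq_sum // => z.
  rewrite mem_index_iota => /andP[nz zb]; have := h (Ordinal zb) => /=.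
  by rewrite nz /=; case: (A z) => //=; case: dep.
have [i0 hi0] : exists i0, [&& (b0 <= i0)%N, (i0 < n + n)%N, ~~ A i0 & ~~ dep v n i0].
  case: (boolP [exists z : 'I_(n + n), [&& (b0 <= z)%N, ~~ A z & ~~ dep v n z]]) => [/existsP[z /and3P[h1 h2 h3]]|].
    by exists z; rewrite h1 h2 h3 ltn_ord.
  rewrite negb_exists => /forallP h; exfalso.
  move: eqn; rewrite (@cnt_cat A n b0 (n + n)) ?(@irk_sum _ _ v n b0 (n + n)); [|rewrite /b0; lia..].
  suff : (\sum_(b0 <= z < n + n) ~~ dep v n z <= cnt A b0 (n + n))%N by lia.
  rewrite /cnt big_seq [X in (_ <= X)%N]big_seq leq_sum // => z.
  rewrite mem_index_iota => /andP[nz zb]; have := h (Ordinal zb) => /=.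
  by rewrite nz /=; case: (A z) => //=; case: dep.
case/and4P: hj0 => nj jb Aj dj; case/and4P: hi0 => bi i2 Ai di.
have [|u [pu hu]] := @dom_step n A v j0 i0 pv n0 nj _ i2 Aj dj Ai di; first lia.
have [t t0 Pt] := PS v u pv pu Pv.
have [d1 d2 [b1 hb1 d3]] := hu t t0.
set v1 := (fun z => v z + t *: u z) in Pt d1 d2 d3.
have le1 c : (n <= c <= n + n)%N -> (irk v1 n c <= cnt A n c)%N.
  move=> hc; have [||g [h1 h2 h3]] := d1.1 n c; [lia|lia|].
  apply: leq_trans h3 _; rewrite (@cnt_cat A n g c) // leq_add2r le //; lia.
have [|||||v2 [h1 h2 h3 h4]] := IH v1.
- apply: leq_trans hm.
  have b1in : b1 \in index_iota n (n + n).+1 by rewrite mem_index_iota; lia.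
  have uq : uniq (index_iota n (n + n).+1) by exact: iota_uniq.
  rewrite [X in (X < _)%N](bigD1_seq b1 b1in uq) [X in (_ < X)%N](bigD1_seq b1 b1in uq) /=.
  rewrite -addSn; apply: leq_add; first by have := le1 b1 hb1; lia.
  rewrite big_seq_cond [X in (_ <= X)%N]big_seq_cond leq_sum // => c.
  rewrite mem_index_iota => /andP[hc _]; have := d2 c ltac:(lia); lia.
- by move=> z; rewrite /v1 pv pu.
- exact: le1.
- apply/eqP; rewrite eqn_leq le1; last by lia.
  by rewrite -eqn d2 //; lia.
- by [].
by exists v2; split=> //; apply: dom_trans h3 d1.
Qed.

Lemma irk_leq_nonzero v a b : (irk v a b <= cnt (fun z => v z != 0%R) a b)%N.
Proof.
elim: b => [|b IH]; first by rewrite irk0.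
have [ab|ba] := leqP a b; last by rewrite irk0.
rewrite irk_dep // cnt_recr // leq_add //.
by rewrite /dep; have [->|_] := eqVneq (v b) 0; rewrite ?sub0mx //; exact: leq_b1.
Qed.

Lemma eq_irk v v' a b : v =1 v' -> irk v a b = irk v' a b.
Proof. by move=> e; rewrite /irk /ispan (eq_bigr (fun z : 'I_b => <<v' z>>%MS)) // => z _; rewrite e. Qed.

End Dom.

(** * Counting the entries of column sets *)

Section Entries.
Variables (k n : nat).
Implicit Types (a b : KSub k n).

Lemma card_KSub a : #|val a| = k. Proof. exact: (eqP (valP a)). Qed.

Lemma size_entries a : size (entries a) = k.
Proof. by rewrite size_map -cardE card_KSub. Qed.

Lemma entries_sorted a : sorted ltn (entries a).
Proof.
have -> : entries a = filter (fun x => if insub x is Some j then j \in val a else false) (iota 0 n).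
  rewrite /entries -val_enum_ord filter_map; congr map.
  rewrite {1}/enum_mem -enumT; apply: eq_filter => j /=.
  by rewrite valK.
by apply: sorted_filter; [exact: ltn_trans | exact: iota_ltn_sorted].
Qed.

Lemma entries_uniq a : uniq (entries a).
Proof. exact: (sorted_uniq ltn_trans ltnn (entries_sorted a)). Qed.

Lemma mem_entries a (j : 'I_n) : (val j \in entries a) = (j \in val a).
Proof. by rewrite mem_map ?mem_enum //; exact: val_inj. Qed.

Lemma entries_ltn a x : x \in entries a -> (x < n)%N.
Proof. by case/mapP => j _ ->; exact: ltn_ord. Qed.

Definition colix a (c : 'I_k) : 'I_n := enum_val (cast_ord (esym (card_KSub a)) c).

Lemma colix_mem a c : colix a c \in val a. Proof. exact: enum_valP. Qed.

Lemma index_colix a c : index (colix a c) (enum (val a)) = c.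
Proof.
rewrite /colix (enum_val_nth (colix a c)) index_uniq ?enum_uniq //= -cardE card_KSub.
exact: ltn_ord.
Qed.

Lemma colixE a (c : 'I_k) : nat_of_ord (colix a c) = nth 0%N (entries a) c.
Proof.
rewrite /colix (enum_val_nth (colix a c)) /= (nth_map (colix a c)) //.
by rewrite -cardE card_KSub.
Qed.

Lemma colixP a j : j \in val a -> exists c, j = colix a c.
Proof.
move=> ja; have hi : (index j (enum (val a)) < k)%N.
  by rewrite -[X in (_ < X)%N](card_KSub a) cardE index_mem mem_enum.
by exists (Ordinal hi); rewrite /colix (enum_val_nth j) /= nth_index // mem_enum.
Qed.

Definition inA a : pred nat := fun z => (z %% n)%N \in entries a.

Lemma inA_small a z : (z < n)%N -> inA a z = (z \in entries a).
Proof. by move=> h; rewrite /inA modn_small. Qed.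

Lemma inA_shift a z : inA a (n + z)%N = inA a z.
Proof. by rewrite /inA modnDl. Qed.

Lemma cnt_inA a y : (y <= n)%N ->
  cnt (inA a) n (n + y) = (\sum_(p < k) (nth 0 (entries a) p < y))%N.
Proof.
move=> yn; rewrite /cnt -{1}[n]add0n big_addn addKn.
transitivity (\sum_(0 <= z < y) (z \in entries a))%N.
  by apply: eq_big_nat => z /andP[_ zy]; rewrite addnC inA_shift inA_small //; lia.
transitivity (\sum_(e <- entries a) (e < y))%N; last first.
  by rewrite (big_nth 0%N) size_entries big_mkord.
under eq_bigr => z _ do rewrite -(count_uniq_mem _ (entries_uniq a)) -sum1_count big_mkcond /=.
rewrite exchange_big /=; apply: eq_bigr => e _.
case: (ltnP e y) => ey.
  rewrite (bigD1_seq e) ?iota_uniq ?mem_index_iota //=.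
  by rewrite eqxx big1 // => z /negbTE; rewrite eq_sym => ->.
rewrite big_nat big1 // => z /andP[_ zy]; rewrite ifN //; lia.
Qed.

Lemma cnt_inA_full a x : (0 < n)%N -> cnt (inA a) x (x + n) = k.
Proof.
move=> n0; elim: x => [|x IH].
  rewrite add0n /cnt.
  have -> : (\sum_(0 <= z < n) inA a z = \sum_(n <= z < n + n) inA a z)%N.
    symmetry.
    rewrite -[X in \sum_(X <= _ < _) _ ]add0n big_addn addnK; apply: eq_bigr => z _.
    by rewrite addnC inA_shift.
  rewrite -/(cnt _ _ _) cnt_inA // -[RHS]card_ord -sum1_card.
  apply: eq_bigr => p _; rewrite (entries_ltn (a := a)) //.
  by rewrite mem_nth // size_entries.
rewrite addSn cnt_recr; last by lia.
have := IH; rewrite cnt_recl; last by lia.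
by rewrite addnC => <-; congr addn; rewrite addnC inA_shift.
Qed.

Lemma nth_entries_lt a i j : (i < j < k)%N -> (nth 0 (entries a) i < nth 0 (entries a) j)%N.
Proof.
move=> h; apply: (sorted_ltn_nth ltn_trans) (entries_sorted a) _ _ _ _ _; rewrite ?inE ?size_entries; lia.
Qed.

Lemma pleq_cnt a b y : (y <= n)%N -> pleq a b ->
  (cnt (inA b) n (n + y) <= cnt (inA a) n (n + y))%N.
Proof.
move=> yn h; rewrite !cnt_inA //; apply: leq_sum => p _.
by have := h p; case: ltnP => // hb; case: ltnP => // ha; lia.
Qed.

Lemma cnt_le_index a (i : 'I_k) y : (y <= n)%N -> (y <= nth 0 (entries a) i)%N ->
  (cnt (inA a) n (n + y) <= i)%N.
Proof.
move=> yn h; rewrite cnt_inA //.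
apply: leq_trans (_ : \sum_(p < k) (p < i)%N <= _)%N.
  apply: leq_sum => p _; case: ltnP => // hp; case: ltnP => // ip.
  have [e|ne] := eqVneq (i : nat) p; first by move: hp; rewrite -e; lia.
  have := @nth_entries_lt a i p ltac:(have := ltn_ord p; lia); lia.
have ik := ltn_ord i.
rewrite (eq_bigr (fun p : 'I_k => if (p < i)%N then 1%N else 0%N)); last by move=> p _; case: ltnP.
by rewrite -big_mkcond /= -(big_ord_widen k (fun=> 1%N)) ?sum1_card ?card_ord //; exact: ltnW.
Qed.

End Entries.

(** * Minors, pivots and generic perturbation *)

Section Minors.
Variables (K : fieldType) (k n : nat).
Implicit Types (a b : KSub k n) (v u : nat -> 'rV[K]_k).

Lemma minorE (V : 'M[K]_(k, n)) a :
  minor V a = \det (\matrix_(r < k, c < k) V r (colix a c)).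
Proof.
congr (\det _); apply/matrixP => r c; rewrite !mxE (big_pred1 (colix a c)) // => j /=.
apply/andP/eqP => [[ja /eqP e]| ->]; last by rewrite colix_mem index_colix.
by have [c' ec] := colixP ja; move: e; rewrite ec index_colix => /val_inj ->.
Qed.

Definition mat v : 'M[K]_(k, n) := \matrix_(r, j) v j 0 r.

Definition pivmx v a : 'M[K]_k := \matrix_(c < k) v (colix a c).

Lemma minor_mat v a : minor (mat v) a = \det (pivmx v a).
Proof.
rewrite minorE -det_tr; congr (\det _); apply/matrixP => r c.
by rewrite !mxE.
Qed.

Lemma row_pivmx v a c : row c (pivmx v a) = v (colix a c).
Proof. by rewrite rowK. Qed.

(** Following the window, every [v z] lies in the span of the columns in [a]: pivots are such
    columns and other vectors depend on earlier ones. The window has rank [k]. *)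
Lemma minor_pivots_neq0 v a : (0 < n)%N -> (forall z, v (z + n)%N = v z) ->
  (forall b : nat, (n <= b <= n + n)%N -> irk v n b = cnt (inA a) n b) ->
  minor (mat v) a != 0.
Proof.
move=> n0 pv h; rewrite minor_mat -unitfE -[_ \is a _]/(pivmx v a \in unitmx) -row_full_unit.
have hz z : (n <= z < n + n)%N -> (v z <= pivmx v a)%MS.
  elim/ltn_ind: z => z IH hz.
  have := h z.+1 ltac:(lia); rewrite irk_dep; last by lia.
  rewrite h; last by lia.
  rewrite cnt_recr; last by lia.
  case: (boolP (inA a z)) => az; case: (boolP (dep v n z)) => //= dz; try by lia.
    move=> _; have zn : (z - n < n)%N by lia.
    have : Ordinal zn \in val a.
      rewrite -mem_entries /=; move: az; rewrite -{1}(@subnKC n z); last by lia.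
      by rewrite inA_shift inA_small.
    case/colixP => c ec; rewrite -{1}(@subnK n z); last by lia.
    have -> : (z - n = colix a c)%N by rewrite -ec.
    by rewrite pv -row_pivmx row_sub.
  move=> _; apply: submx_trans dz _; apply: ispan_sub => y h1 h2; apply: IH => //; lia.
rewrite /row_full eqn_leq rank_leq_row /=.
rewrite -{1}(cnt_inA_full a n n0) -h; last by lia.
by apply: mxrankS; apply: ispan_sub => z h1 h2; apply: hz; rewrite h1.
Qed.

(** The pivots form the least basis: if entry [i] of [b] were below that of [a], the first [i + 1]
    columns of [b] would lie in an initial span of rank at most [i]. *)
Lemma minor_pivots_pleq v a b : (forall z, v (z + n)%N = v z) ->
  (forall b : nat, (n <= b <= n + n)%N -> irk v n b = cnt (inA a) n b) ->
  minor (mat v) b != 0 -> pleq a b.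
Proof.
move=> pv h; rewrite minor_mat -unitfE -[_ \is a _]/(pivmx v b \in unitmx) => ub i.
rewrite leqNgt; apply/negP => lt.
have ik := ltn_ord i.
set y := nth 0%N (entries b) i in lt.
have yn : (y < n)%N by rewrite (@entries_ltn _ _ b) // mem_nth // size_entries.
have c1 := @cnt_le_index k n a i y.+1 yn lt.
have : (\rank ((pid_mx i.+1 : 'M[K]_k) *m pivmx v b) <= irk v n (n + y.+1))%N.
  apply/mxrankS/row_subP => p; rewrite row_mul.
  have [pi|ip] := leqP p i.
    have -> : row p (pid_mx i.+1) = delta_mx 0 p :> 'rV[K]_k.
      apply/rowP => q; rewrite !mxE ltnS pi andbT eqxx /= eq_sym.
      by rewrite -(inj_eq val_inj).
    rewrite -rowE row_pivmx -pv mem_ispan; [by []|lia|].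
    rewrite colixE addnC ltn_add2l ltnS /y; have [->//|ne] := eqVneq (p : nat) i.
    apply: ltnW; apply: nth_entries_lt; rewrite ik andbT; lia.
  have -> : row p (pid_mx i.+1) = 0 :> 'rV[K]_k.
    by apply/rowP => q; rewrite !mxE ltnS leqNgt ip andbF.
  by rewrite mul0mx sub0mx.
rewrite mxrankMfree; last by rewrite row_free_unit.
rewrite rank_pid_mx // h; last by lia.
by move=> c2; move: (leq_trans c2 c1); rewrite ltnn.
Qed.

Lemma Gr_mat v : (0 < n)%N -> (forall z, v (z + n)%N = v z) ->
  irk v n (n + n) = k -> Gr (mat v).
Proof.
move=> n0 pv h; rewrite /Gr -mxrank_tr; apply/eqP; rewrite eqn_leq rank_leq_col /=.
apply: leq_trans (_ : irk v n (n + n) <= _)%N; first by rewrite h.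
apply/mxrankS/ispan_sub => z h1 h2.
have zn : (z - n < n)%N by lia.
have -> : v z = row (Ordinal zn) (mat v)^T.
  by apply/rowP => r; rewrite !mxE /= -{1}(subnK h1) pv.
exact: row_sub.
Qed.

Definition polyfun (f : K -> K) := exists q : {poly K}, forall t, f t = q.[t].

Lemma polyfun_cst c : polyfun (fun=> c).
Proof. by exists c%:P => t; rewrite hornerC. Qed.

Lemma polyfun_sum (I : Type) (r : seq I) (F : I -> K -> K) :
  (forall i, polyfun (F i)) -> polyfun (fun t => \sum_(i <- r) F i t).
Proof.
move=> h; elim: r => [|i r [q hq]].
  by exists 0 => t; rewrite big_nil horner0.
have [q' hq'] := h i; exists (q' + q) => t.
by rewrite big_cons hq hq' hornerD.
Qed.

Lemma polyfun_prod (I : Type) (r : seq I) (F : I -> K -> K) :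
  (forall i, polyfun (F i)) -> polyfun (fun t => \prod_(i <- r) F i t).
Proof.
move=> h; elim: r => [|i r [q hq]].
  by exists 1 => t; rewrite big_nil hornerC.
have [q' hq'] := h i; exists (q' * q) => t.
by rewrite big_cons hq hq' hornerM.
Qed.

Lemma polyfun_mul f g : polyfun f -> polyfun g -> polyfun (fun t => f t * g t).
Proof. by case=> p hp [q hq]; exists (p * q) => t; rewrite hp hq hornerM. Qed.

Lemma polyfun_exp f m : polyfun f -> polyfun (fun t => f t ^+ m).
Proof. by case=> p hp; exists (p ^+ m) => t; rewrite hp horner_exp. Qed.

(** In characteristic 0 the elements [1, ..., size q] are distinct, nonzero and too many to be all
    roots of [q]. *)
Lemma nonroot_neq0 (q : {poly K}) : [pchar K] =i pred0 -> q != 0 ->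
  exists2 t, t != 0 & q.[t] != 0.
Proof.
move=> ch q0.
pose s := [seq (i.+1)%:R : K | i <- iota 0 (size q)].
have us : uniq s.
  rewrite map_inj_in_uniq ?iota_uniq // => i j _ _ e.
  have nat0 m : (m%:R == 0 :> K) = (m == 0)%N by move: m; apply/pcharf0P.
  wlog ij : i j e / (i <= j)%N.
    by move=> H; case: (leqP i j) => h; [exact: H | symmetry; apply: H => //; exact: ltnW].
  have : (j - i)%:R == 0 :> K.
    by rewrite natrB // subr_eq0; move/eqP: e; rewrite -!natr1 (inj_eq (addIr _)) eq_sym.
  by rewrite nat0; lia.
have [h|/allPn[t /mapP[i _ ->] ht]] := boolP (all (root q) s).
  by have := max_poly_roots q0 h us; rewrite size_map size_iota ltnn.
exists i.+1%:R; last by [].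
by rewrite (proj1 (pcharf0P K) ch).
Qed.

(** An explicit list of exponents lets a Plücker variable be factored out by re-indexing. *)
Definition evalm (V : 'M[K]_(k, n)) (s : seq 'X_{1..N k n}) (c : 'X_{1..N k n} -> K) : K :=
  \sum_(m <- s) c m * \prod_(i < N k n) plucker V i ^+ m i.

(** Along the line [v + t u] the value is a polynomial in [t], nonzero at [t = 0]. *)
Lemma evalm_perturb v u s c : [pchar K] =i pred0 -> evalm (mat v) s c != 0 ->
  exists2 t, t != 0 & evalm (mat (fun z => v z + t *: u z)) s c != 0.
Proof.
move=> ch h.
have [q hq] : polyfun (fun t => evalm (mat (fun z => v z + t *: u z)) s c).
  apply: polyfun_sum => m; apply: polyfun_mul; first exact: polyfun_cst.
  apply: polyfun_prod => i; apply: polyfun_exp; rewrite /plucker.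
  have [f hf] : polyfun (fun t => \sum_(g : {perm 'I_k}) (-1) ^+ g *
     \prod_(r < k) ((v (colix (enum_val i) r) 0 (g r)) + t * u (colix (enum_val i) r) 0 (g r))).
    apply: polyfun_sum => g; apply: polyfun_mul; first exact: polyfun_cst.
    apply: polyfun_prod => r; exists ((v (colix (enum_val i) r) 0 (g r))%:P + (u (colix (enum_val i) r) 0 (g r)) *: 'X).
    by move=> t; rewrite hornerD hornerC hornerZ hornerX mulrC.
  exists f => t; rewrite -hf minor_mat; apply: eq_bigr => g _; congr (_ * _).
  by apply: eq_bigr => r _; rewrite !mxE.
have e0 : q.[0] = evalm (mat v) s c.
  rewrite -hq; congr (evalm _ s c); apply/matrixP => r j.
  by rewrite !mxE mul0r addr0.
have q0 : q != 0 by apply: contra h => /eqP z; rewrite -e0 z horner0.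
have [t t0 ht] := nonroot_neq0 ch q0.
by exists t => //; rewrite hq.
Qed.

End Minors.

(** * The point attached to a standard monomial *)

Section Coordinate.
Variables (K : fieldType) (k n : nat).
Implicit Types (a b : KSub k n).

(** The coordinate subspace whose only nonzero Plücker coordinate is [[a]]. *)
Definition coordseq a (z : nat) : 'rV[K]_k :=
  \row_(p < k) (nth 0%N (entries a) p == (z %% n)%N)%:R.

Lemma coordseq_periodic a z : coordseq a (z + n) = coordseq a z.
Proof. by rewrite /coordseq modnDr. Qed.

Lemma coordseq_neq0 a z : coordseq a z != 0 -> inA a z.
Proof.
case/rV0Pn => p; rewrite mxE; have [e _|_] := eqVneq (nth 0%N (entries a) p) (z %% n)%N; last by rewrite eqxx.
by rewrite /inA -e mem_nth // size_entries.
Qed.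

Lemma irk_coordseq a x y : (irk (coordseq a) x y <= cnt (inA a) x y)%N.
Proof.
apply: leq_trans (irk_leq_nonzero _ _ _) _; apply: leq_sum => z _.
by case: (boolP (coordseq a z != 0)) => // /coordseq_neq0 ->.
Qed.

Lemma irk_coordseq_full a : (0 < n)%N -> irk (coordseq a) n (n + n) = k.
Proof.
move=> n0; apply/eqP; rewrite eqn_leq rank_leq_col /= -{1}(mxrank1 K k).
apply/mxrankS/row_subP => p.
have pn : (nth 0%N (entries a) p < n)%N.
  by rewrite (@entries_ltn _ _ a) // mem_nth // size_entries.
have -> : row p 1%:M = coordseq a (n + nth 0%N (entries a) p).
  apply/rowP => q; rewrite !mxE modnDl modn_small //.
  rewrite nth_uniq ?size_entries ?entries_uniq // -(inj_eq val_inj) /=.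
  by rewrite eq_sym.
apply: mem_ispan; lia.
Qed.

Lemma irk_coordseq_pivots a y : (0 < n)%N -> (n <= y <= n + n)%N ->
  irk (coordseq a) n y = cnt (inA a) n y.
Proof.
move=> n0 hy; apply/eqP; rewrite eqn_leq irk_coordseq /=.
have := irk_coordseq_full a n0; rewrite -{2}(cnt_inA_full a n n0).
rewrite (@irk_sum _ _ _ n y (n + n)) ?(@cnt_cat _ n y (n + n)); [|lia..].
suff : (\sum_(y <= z < n + n) ~~ dep (coordseq a) n z <= cnt (inA a) y (n + n))%N by lia.
apply: leq_sum => z _; case: (boolP (inA a z)) => [_|h]; first exact: leq_b1.
rewrite /dep; have -> : coordseq a z = 0.
  by apply/eqP; move: h; apply: contraR => /coordseq_neq0.
by rewrite sub0mx.
Qed.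

End Coordinate.

Section Standard.
Variables (K : fieldType) (k n : nat).
Hypothesis charK0 : [pchar K] =i pred0.
Hypothesis n_gt0 : (0 < n)%N.
Variable rk : KSub k n -> nat.
Hypothesis hrk : lin_ext rk.
Implicit Types (a b : KSub k n) (v u : nat -> 'rV[K]_k) (M m : 'X_{1..N k n}).

Definition tabm d (T : nat -> KSub k n) : 'X_{1..N k n} :=
  (\sum_(i < d) U_(enum_rank (T i)))%MM.

Lemma tabmS d T : tabm d.+1 T = (U_(enum_rank (T 0%N)) + tabm d (fun i => T i.+1))%MM.
Proof. by rewrite /tabm big_ord_recl. Qed.

Definition lead_family M (s : seq 'X_{1..N k n}) (c : 'X_{1..N k n} -> K) :=
  [/\ uniq s, M \in s, c M != 0, forall m, m \in s -> mdeg m = mdeg M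
    & forall m, m \in s -> m != M -> grevlex_gt rk M m].

Lemma lead_family0 (V : 'M[K]_(k, n)) s c : lead_family 0%MM s c -> evalm V s c != 0.
Proof.
case=> us s0 c0 hd _; rewrite /evalm (bigD1_seq 0%MM) //= [X in _ + X]big1_seq ?addr0.
  by rewrite big1 ?mulr1 // => i _; rewrite mnm0E expr0.
move=> m /andP[m0 /hd]; rewrite mdeg0 => /eqP; rewrite mdeg_eq0 => e.
by rewrite e in m0.
Qed.

Section Restrict.
Variables (a : KSub k n) (M' : 'X_{1..N k n}) (s : seq 'X_{1..N k n}) (c : 'X_{1..N k n} -> K).
Let ia : 'I_(N k n) := enum_rank a.
Hypothesis lf : lead_family (U_(ia) + M')%MM s c.

Definition restr_s := [seq (m - U_(ia))%MM | m <- s & (0 < m ia)%N].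
Definition restr_c m := c (m + U_(ia))%MM.

Let subK m : (0 < m ia)%N -> (m - U_(ia) + U_(ia) = m)%MM.
Proof. by move=> h; rewrite submK // lep1mP -lt0n. Qed.

Lemma restr_lead : lead_family M' restr_s restr_c.
Proof.
case: lf => us Ms cM hd hl.
have injs : {in [seq m : 'X_{1..N k n} <- s | (0 < m ia)%N] &, injective (fun m => (m - U_(ia))%MM)}.
  move=> m1 m2; rewrite !mem_filter => /andP[h1 _] /andP[h2 _] e.
  by rewrite -(subK h1) -(subK h2) e.
have M0 : (0 < (U_(ia) + M')%MM ia)%N by rewrite mnmDE mnm1E eqxx.
split.
- by rewrite map_inj_in_uniq // filter_uniq.
- apply/mapP; exists (U_(ia) + M')%MM; first by rewrite mem_filter M0.
  by rewrite addmC addmK.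
- by rewrite /restr_c addmC.
- move=> m /mapP[m1]; rewrite mem_filter => /andP[h1 m1s] ->.
  have := hd _ m1s; rewrite -{1}(subK h1) !mdegD mdeg1; lia.
- move=> m /mapP[m1]; rewrite mem_filter => /andP[h1 m1s] -> ne.
  have {}ne : m1 != (U_(ia) + M')%MM.
    by apply: contra ne => /eqP ->; rewrite addmC addmK.
  case: (hl _ m1s ne) => [|[e [v [hv1 hv2]]]].
    by rewrite (hd _ m1s) ltnn.
  right; split.
    have := hd _ m1s; rewrite -{1}(subK h1) !mdegD mdeg1; lia.
  exists v; split.
    by move: hv1; rewrite -{1}(subK h1) !mnmDE; lia.
  by move=> w /hv2; rewrite -{1}(subK h1) !mnmDE; lia.
Qed.

(** At a point with pivots [a], every variable ranked below [a] vanishes. In reverse lexicographic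
    order a monomial below the leading one and not divisible by [[a]] contains such a variable, so
    only multiples of [[a]] survive. *)
Lemma evalm_restr v : (forall z, v (z + n)%N = v z) ->
  (forall y, (n <= y <= n + n)%N -> irk v n y = cnt (inA a) n y) ->
  evalm (mat n v) s c = minor (mat n v) a * evalm (mat n v) restr_s restr_c.
Proof.
case: lf => us Ms cM hd hl pv piv.
rewrite /evalm /restr_s big_map big_filter [LHS](bigID (fun m => (0 < m ia)%N)) /=.
rewrite [X in _ + X]big_seq_cond [X in _ + X]big1 ?addr0; last first.
  move=> m /andP[ms]; rewrite -eqn0Ngt => /eqP m0.
  have ne : m != (U_(ia) + M')%MM.
    by apply/eqP => e; move: m0; rewrite e mnmDE mnm1E eqxx.
  case: (hl _ ms ne) => [|[e [w [hw1 hw2]]]].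
    by rewrite (hd _ ms) ltnn.
  have lt : (rk (enum_val w) < rk a)%N.
    rewrite ltnNge; apply/negP; rewrite leq_eqVlt => /orP[/eqP e'|lt].
      have ew : w = ia by rewrite /ia (hrk.1 _ _ e') enum_valK.
      by move: hw1; rewrite ew m0.
    have := hw2 ia; rewrite enum_rankK => /(_ lt); rewrite m0 mnmDE mnm1E eqxx.
    by [].
  have p0 : plucker (mat n v) w = 0.
    apply/eqP; apply: contraLR lt => h; rewrite -leqNgt; apply: hrk.2.
    exact: minor_pivots_pleq pv piv h.
  apply/eqP; rewrite mulf_eq0; apply/orP; right.
  rewrite (bigD1 w) //= p0 expr0n; case: (m w) hw1 => [|x] //= _.
  by rewrite mul0r.
rewrite big_distrr /=; apply: eq_bigr => m h.
rewrite /restr_c subK // [RHS]mulrCA; congr (_ * _).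
rewrite -{1}(subK h).
under eq_bigr => i _ do rewrite mnmDE exprD.
rewrite big_split /= mulrC; congr (_ * _).
rewrite (bigD1 ia) //= mnm1E eqxx expr1 big1 ?mulr1.
  by rewrite /plucker enum_rankK.
by move=> i /negbTE ne; rewrite mnm1E eq_sym ne expr0.
Qed.

End Restrict.

(* The thresholds [g] cut the interval (for [boundW], its complement) into consecutive
   pieces, the [c]-th of which is measured by the column [T c]. *)
Definition boundN d (T : nat -> KSub k n) v := forall x y, (n <= x <= y)%N -> (y <= n + n)%N ->
  exists g : nat -> nat, [/\ g 0%N = y, forall c, (g c.+1 <= g c)%N, forall c, (x <= g c)%N &
    (irk v x y <= \sum_(c < d.+1) cnt (inA (T c)) (g c.+1) (g c))%N].

Definition boundW d (T : nat -> KSub k n) v := forall x y, (x < n)%N -> (n <= y <= x + n)%N ->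
  exists g : nat -> nat, [/\ g 0%N = y, forall c, (g c <= g c.+1)%N, forall c, (g c <= x + n)%N,
    g d.+1 = (x + n)%N & (irk v x y + \sum_(c < d.+1) cnt (inA (T c)) (g c) (g c.+1) <= k)%N].

(** Induction on the number of columns: the shifted tableau gives a point with pivots [T 1] at which
    the quotient by [[T 0]] is nonzero; its pivots are then moved to [T 0], and each bound receives
    one more threshold. *)
Lemma standard_point d (T : nat -> KSub k n) s c :
  (forall i j, (i <= j <= d)%N -> pleq (T i) (T j)) ->
  lead_family (tabm d.+1 T) s c ->
  exists v, [/\ forall z, v (z + n)%N = v z,
    forall y, (n <= y <= n + n)%N -> irk v n y = cnt (inA (T 0%N)) n y,
    evalm (mat n v) s c != 0, boundN d T v & boundW d T v].
Proof.
elim: d T s c => [|d IH] T s c chT; rewrite tabmS => lf; have lf' := restr_lead lf.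
  have piv := @irk_coordseq_pivots K k n (T 0) _ n_gt0.
  exists (coordseq K (T 0)); split=> //; first exact: coordseq_periodic.
  - rewrite (evalm_restr lf) //; last exact: coordseq_periodic.
    rewrite mulf_neq0 //.
      by apply: minor_pivots_neq0 => //; exact: coordseq_periodic.
    by apply: lead_family0; move: lf'; rewrite /tabm big_ord0.
  - move=> x y hxy hy; exists (fun i => if i is 0 then y else x); split=> //.
    + by case=> //; lia.
    + by case=> //; lia.
    + by rewrite big_ord1 irk_coordseq.
  - move=> x y hx hy; exists (fun i => if i is 0 then y else (x + n)%N); split=> //.
    + by case=> //; lia.
    + by case=> //; lia.
    (* [[x, y)] and [[y, x + n)] form a full period, which contains [k] entries. *)
    rewrite big_ord1 -[X in (_ <= X)%N](cnt_inA_full (T 0) x n_gt0).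
    rewrite (@cnt_cat _ x y (x + n)); [|lia..].
    by rewrite leq_add2r irk_coordseq.
have [|v1 [pv1 piv1 ev1 N1 W1]] := IH (fun i => T i.+1) _ _ _ lf'.
  by move=> i j hij; apply: chT; lia.
have p01 : pleq (T 0) (T 1) by apply: chT.
have [|||v [pv ev dv piv]] := @fill_pivots K k n (inA (T 0%N))
   (fun v => evalm (mat n v) (restr_s (T 0) s) (restr_c (T 0) c) != 0) v1 n_gt0 pv1 _ _ ev1.
- move=> y hy; rewrite piv1 // -(@subnKC n y); last by lia.
  by apply: pleq_cnt => //; lia.
- by rewrite piv1 ?cnt_inA_full //; lia.
- by move=> w u _ _; exact: evalm_perturb.
exists v; split=> //.
- rewrite (evalm_restr lf) // mulf_neq0 //.
  exact: minor_pivots_neq0.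
- move=> x y hxy hy.
  have [g [xg gy hg]] := dv.1 x y hxy hy.
  have [||g1 [e1 h1 h2 h3]] := N1 x g; [lia|lia|].
  exists (fun i => if i is i'.+1 then g1 i' else y); split=> //.
  + by case=> [|i]; rewrite ?e1.
  + by case=> [|i] //; lia.
  + by apply: leq_trans hg _; rewrite big_ord_recl /= e1 addnC leq_add2l.
- move=> x y hx hy.
  have [g [xg gy hg]] := dv.2 x y hx hy.
  have [||g1 [e1 h1 h2 h3 h4]] := W1 x g; [lia|lia|].
  exists (fun i => if i is i'.+1 then g1 i' else y); split=> //.
  + by case=> [|i]; rewrite ?e1.
  + by case=> [|i] //; lia.
  + rewrite big_ord_recl /= e1 addnA; apply: leq_trans h4.
    by rewrite leq_add2r.
Qed.

End Standard.

(** * Shuffle polynomials *)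

Section Subdet.
Variables (K : fieldType) (q n : nat).
Implicit Types (C : KSub q n) (U : 'M[K]_(q, n)) (s : {perm 'I_n}) (f : 'I_n -> 'I_n).

Lemma big_colix (R : Type) (idx : R) (op : Monoid.com_law idx) C (P : pred 'I_n) (F : 'I_n -> R) :
  \big[op/idx]_(b in val C | P b) F b = \big[op/idx]_(p < q | P (colix C p)) F (colix C p).
Proof.
rewrite big_mkcondr /= big_enum_val /= [RHS]big_mkcond /=.
rewrite (reindex (cast_ord (esym (card_KSub C)))) //=.
by apply: onW_bij; exists (cast_ord (card_KSub C)) => x; apply: val_inj.
Qed.

Lemma colix_inj C : injective (colix C).
Proof. by move=> p p' e; apply: val_inj => /=; rewrite -(index_colix C p) e index_colix. Qed.

Definition subdet U f C : K := \det (\matrix_(r < q, p < q) U r (f (colix C p))).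

(** When [f] maps [C] bijectively to [C'], this is a permutation matrix whose determinant is the
    sign of sorting the images. *)
Definition relmx f C C' : 'M[K]_q := \matrix_(p, p') (f (colix C p') == colix C' p)%:R.

Lemma subdet_rel U f C C' : f @: val C \subset val C' ->
  subdet U f C = minor U C' * \det (relmx f C C').
Proof.
move=> sub; rewrite minorE -det_mulmx; congr (\det _); apply/matrixP => r p.
rewrite !mxE; have [p1 ep] : exists p1, f (colix C p) = colix C' p1.
  by apply: colixP; apply: (subsetP sub); apply: imset_f; exact: colix_mem.
rewrite (bigD1 p1) //= !mxE ep eqxx mulr1 big1 ?addr0 // => p2 ne.
by rewrite !mxE ep (inj_eq (@colix_inj C')) eq_sym (negbTE ne) mulr0.
Qed.

Lemma subdet_small U f C : #|f @: val C| != q -> subdet U f C = 0.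
Proof.
move=> h; have : ~~ [forall p, forall p', (f (colix C p) == f (colix C p')) ==> (p == p')].
  apply: contra h => /forallP h; rewrite -[X in _ == X](card_KSub C); apply/eqP/card_in_imset.
  move=> x y /colixP[p ->] /colixP[p' ->] e; congr colix; apply/eqP.
  by have /forallP/(_ p')/implyP := h p; apply; rewrite e.
case/forallPn => p /forallPn[p']; rewrite negb_imply => /andP[/eqP e ne].
rewrite /subdet -det_tr; apply: (determinant_alternate ne) => r.
by rewrite !mxE e.
Qed.

End Subdet.

(** * Selection matrices and signs *)

Section Selection.
Variable K : fieldType.

Definition selmx q n (C : KSub q n) : 'M[K]_(n, q) := \matrix_(j, p) (j == colix C p)%:R.

Lemma mul_selmx m q n (U : 'M[K]_(m, n)) (C : KSub q n) r p :
  (U *m selmx C) r p = U r (colix C p).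
Proof.
rewrite mxE (bigD1 (colix C p)) //= mxE eqxx mulr1 big1 ?addr0 // => j ne.
by rewrite mxE (negbTE ne) mulr0.
Qed.

Lemma minor_selmx q n (U : 'M[K]_(q, n)) (C : KSub q n) : minor U C = \det (U *m selmx C).
Proof. by rewrite minorE; congr (\det _); apply/matrixP => r p; rewrite mul_selmx mxE. Qed.

Lemma selmxK q n (C : KSub q n) : (selmx C)^T *m selmx C = 1%:M.
Proof.
by apply/matrixP => x y; rewrite mul_selmx !mxE (inj_eq (@colix_inj _ _ C)) eq_sym.
Qed.

Lemma selmx_disjoint q q' n (C : KSub q n) (D : KSub q' n) : val D = ~: val C ->
  (selmx C)^T *m selmx D = 0.
Proof.
move=> e; apply/matrixP => x y; rewrite mul_selmx !mxE; case: eqP => // h.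
by have := colix_mem D y; rewrite e inE h colix_mem.
Qed.

Lemma det_row_selmx q q' (C : KSub q (q + q')) (D : KSub q' (q + q')) :
  val D = ~: val C -> \det (row_mx (selmx C) (selmx D)) != 0.
Proof.
move=> e; have e' : val C = ~: val D by rewrite e setCK.
have : (row_mx (selmx C) (selmx D))^T *m row_mx (selmx C) (selmx D) = 1%:M.
  by rewrite tr_row_mx mul_col_row !selmxK !selmx_disjoint // -scalar_mx_block.
move/(congr1 determinant); rewrite det_mulmx det1 => h; apply/eqP => z.
by move: h; rewrite z mulr0 => /eqP; rewrite eq_sym oner_eq0.
Qed.

End Selection.

Lemma KSub_leq q n (C : KSub q n) : (q <= n)%N.
Proof. by rewrite -(card_KSub C) -[X in (_ <= X)%N]card_ord max_card. Qed.

(** Completed by the identity on the complement of [C], [relmx] becomes conjugate to the transposed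
    permutation matrix of [s]. *)
Lemma relmx_perm (K : fieldType) q n (s : {perm 'I_n}) (C : KSub q n) :
  perm_on (val C) s -> \det (relmx K s C C) = (-1) ^+ s.
Proof.
move=> ps; have [q' e] : exists q', n = (q + q')%N.
  by exists (n - q)%N; rewrite subnKC ?(KSub_leq C).
subst n.
have cD : #|~: val C| == q' by rewrite cardsCs setCK card_KSub card_ord addKn.
pose D : KSub q' (q + q') := Sub (~: val C) cD.
pose P := row_mx (selmx K C) (selmx K D).
have eq1 : (perm_mx s)^T *m P = P *m block_mx (relmx K s C C) 0 0 1%:M.
  rewrite mul_mx_row mul_row_block !mulmx0 add0r addr0 mulmx1.
  congr row_mx; apply/matrixP => j p; rewrite mul_selmx !mxE eq_sym.
    have [p1 ep] : exists p1, s (colix C p) = colix C p1.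
      by apply: colixP; rewrite (perm_closed _ ps) colix_mem.
    rewrite (bigD1 p1) //= !mxE ep eqxx mulr1 big1 ?addr0 // => p2 ne.
    by rewrite !mxE ep (inj_eq (@colix_inj _ _ C)) [p1 == p2]eq_sym (negbTE ne) mulr0.
  by rewrite (out_perm ps) //; have := colix_mem D p; rewrite inE.
have := congr1 determinant eq1.
rewrite !det_mulmx det_tr det_perm det_ublock det1 mulr1 mulrC.
by move/(mulfI (det_row_selmx K (erefl : val D = ~: val C))).
Qed.

(** * Alternating sums over block permutations *)

Section Shuffle.
Variables (K : fieldType) (q n : nat).
Implicit Types (U : 'M[K]_(q, n)) (s : {perm 'I_n}).
Variables (d : nat) (C : 'I_d -> KSub q n) (B : 'I_d -> {set 'I_n}).
Hypothesis BC : forall c, B c \subset val (C c).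
Hypothesis Bdisj : forall c c', c != c' -> [disjoint B c & B c'].

Let Bu := \bigcup_c B c.

Definition blockmap s c (x : 'I_n) := if x \in B c then s x else x.

Lemma mem_block_unique c c' x : x \in B c -> x \in B c' -> c = c'.
Proof.
move=> h h'; apply/eqP; apply: contraLR h => /Bdisj/disjointFl/(_ h').
by move=> ->.
Qed.

(* After expanding all determinants, the sum over [s] is, for each choice of row
   permutations [f], a multiple of the determinant of a matrix [Z f] killed by [lam]. *)
Lemma shuffle_vanish U (lam : 'cV[K]_n) : U *m lam = 0 -> lam != 0 ->
  (forall x, x \notin Bu -> lam x 0 = 0) ->
  \sum_(s | perm_on Bu s) (-1) ^+ s * \prod_c subdet U (blockmap s c) (C c) = 0.
Proof.
move=> Ul lam0 lamB.
(* For [b] in a block the double sum has a single term, a row of [U], since block and position of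
   [b] are unique. These rows kill [lam] because [U *m lam = 0], the identity rows because [lam] is
   supported on [Bu]. *)
pose Z (f : {ffun 'I_d -> {perm 'I_q}}) : 'M[K]_n := \matrix_(b, x)
  if b \in Bu then \sum_c \sum_(p | (b \in B c) && (colix (C c) p == b)) U (f c p) x
  else (b == x)%:R.
have detZ f : \det (Z f) = 0.
  apply/eqP; rewrite -det_tr; apply/det0P; exists lam^T; first by rewrite trmx_eq0.
  rewrite -trmx_mul; apply/eqP; rewrite trmx_eq0; apply/eqP/matrixP => b y; rewrite ord1 !mxE.
  under eq_bigr => x _ do rewrite mxE.
  case: (boolP (b \in Bu)) => [_|nb]; last first.
    by rewrite big1 // => x _; case: eqP => [<-|_]; rewrite ?mul0r // lamB ?mulr0.
  under eq_bigr => x _.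
    rewrite mulr_suml; under eq_bigr => c _ do rewrite mulr_suml.
    over.
  rewrite exchange_big big1 //= => c _; rewrite exchange_big big1 //= => p _.
  by have := congr1 (fun M : 'cV_q => M (f c p) 0) Ul; rewrite !mxE.
(* [w f] collects the row signs and the factors outside the blocks, none of which depends on [s]. *)
pose w (f : {ffun 'I_d -> {perm 'I_q}}) : K := \prod_c ((-1) ^+ f c *
   \prod_(p | colix (C c) p \notin B c) U (f c p) (colix (C c) p)).
transitivity (\sum_(f : {ffun 'I_d -> {perm 'I_q}}) w f * \det (Z f)); last first.
  by rewrite big1 // => f _; rewrite detZ mulr0.
transitivity (\sum_(s | perm_on Bu s) \sum_(f : {ffun 'I_d -> {perm 'I_q}})
   w f * ((-1) ^+ s * \prod_b Z f b (s b))); last first.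
  rewrite exchange_big /=; apply: eq_bigr => f _; rewrite -mulr_sumr; congr (_ * _).
  rewrite /(\det _) [RHS](bigID (fun s => perm_on Bu s)) /= [X in _ = _ + X]big1 ?addr0 //.
  move=> s /subsetPn[b]; rewrite inE => sb nb.
  by rewrite (bigD1 b) //= mxE (negbTE nb) eq_sym (negbTE sb) mul0r mulr0.
apply: eq_bigr => s ps.
transitivity ((-1) ^+ s * \prod_c \sum_(g : {perm 'I_q}) ((-1) ^+ g *
   \prod_p U (g p) (blockmap s c (colix (C c) p)))).
  congr (_ * _); apply: eq_bigr => c _; rewrite /subdet -det_tr; apply: eq_bigr => g _.
  by congr (_ * _); apply: eq_bigr => p _; rewrite !mxE.
rewrite bigA_distr_bigA mulr_sumr; apply: eq_bigr => f _.
rewrite [RHS]mulrCA; congr (_ * _).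
have Zin c p : colix (C c) p \in B c -> forall x, Z f (colix (C c) p) x = U (f c p) x.
  move=> h x; rewrite mxE.
  have -> : colix (C c) p \in Bu by apply/bigcupP; exists c.
  rewrite (bigD1 c) //= [X in _ + X]big1 ?addr0.
    by rewrite (big_pred1 p) // => p' /=; rewrite h (inj_eq (@colix_inj _ _ (C c))).
  move=> c' ne; rewrite big_pred0 // => p'; apply/negbTE; rewrite negb_and.
  by apply/orP; left; apply: contra ne => /(mem_block_unique h) ->.
have -> : \prod_b Z f b (s b) = \prod_c \prod_(b in B c) Z f b (s b).
  rewrite -(@partition_disjoint_bigcup _ _ _ _ _ B _ Bdisj) -/Bu.
  rewrite [LHS](bigID (fun b => b \in Bu)) /= [X in _ * X]big1 ?mulr1 //.
  by move=> b nb; rewrite mxE (negbTE nb) (out_perm ps nb) eqxx.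
rewrite /w -big_split; apply: eq_bigr => c _ /=.
rewrite -mulrA; congr (_ * _); rewrite [LHS](bigID (fun p => colix (C c) p \in B c)) mulrC /=.
congr (_ * _); last by apply: eq_bigr => p /negbTE h; rewrite /blockmap h.
rewrite [RHS](eq_bigl (fun b => (b \in val (C c)) && (b \in B c))); last first.
  move=> b; case: (boolP (b \in B c)) => [h|]; last by rewrite andbF.
  by rewrite (subsetP (BC c)).
rewrite big_colix; apply: eq_bigr => p h; rewrite Zin // /blockmap h.
by [].
Qed.

(** Earlier blocks are already filled by their own images, so an element leaving [C c0] lands in a
    block with a larger index. *)
Lemma first_moved_block s (c0 : 'I_d) : perm_on Bu s ->
  (forall c : 'I_d, (c < c0)%N -> s @: B c = B c) -> s @: B c0 != B c0 ->
  #|blockmap s c0 @: val (C c0)| = q ->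
  [/\ blockmap s c0 @: val (C c0) != val (C c0),
      forall x, x \in blockmap s c0 @: val (C c0) -> x \notin val (C c0) ->
        exists2 c' : 'I_d, (c0 < c')%N & x \in B c'
    & forall z, z \in val (C c0) -> z \notin blockmap s c0 @: val (C c0) -> z \in B c0].
Proof.
move=> ps hlt ne card.
have inj : {in val (C c0) &, injective (blockmap s c0)}.
  by apply/imset_injP; rewrite card card_KSub.
split.
- have /subsetPn[x /imsetP[y yB ->] sy] : ~~ (s @: B c0 \subset B c0).
    apply: contra ne => sub; rewrite eqEcard sub card_imset ?leqnn //; exact: (@perm_inj _ s).
  have yC := subsetP (BC c0) _ yB.
  apply/eqP => e.
  have syC : s y \in val (C c0).
    by rewrite -e; apply/imsetP; exists y => //; rewrite /blockmap yB.
  have : s y = y by apply: inj => //; rewrite /blockmap yB (negbTE sy).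
  by move=> h; rewrite h yB in sy.
- move=> x /imsetP[y yC ->]; rewrite {1 2}/blockmap; case: ifP => [yB|_]; last by rewrite yC.
  move=> nC.
  have : s y \in Bu by rewrite (perm_closed _ ps); apply/bigcupP; exists c0.
  case/bigcupP => c' _ sy; exists c' => //.
  rewrite ltn_neqAle; apply/andP; split.
    by apply: contra nC => /eqP/val_inj ->; exact: (subsetP (BC c')).
  rewrite leqNgt; apply/negP => lt.
  move: (sy); rewrite -{1}(hlt c' lt) => /imsetP[y' y'B /perm_inj e].
  by have := mem_block_unique yB; rewrite e => /(_ _ y'B) e'; rewrite e' ltnn in lt.
- move=> z zC; apply: contraR => zB; apply/imsetP; exists z => //.
  by rewrite /blockmap (negbTE zB).
Qed.

Lemma blockmap_inj s c : s @: B c = B c -> injective (blockmap s c).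
Proof.
move=> e x y; rewrite /blockmap.
have mem z : z \in B c -> s z \in B c by move=> h; rewrite -e imset_f.
case: ifP => hx; case: ifP => hy // h; first exact: perm_inj h.
  by rewrite -h mem in hy.
by rewrite h mem in hx.
Qed.

(** Such an [s] is the product of its restrictions to the blocks, so the determinants multiply to
    the sign of [s], which squares to 1. *)
Lemma preserved_sign s : perm_on Bu s -> (forall c, s @: B c = B c) ->
  (-1) ^+ s * \prod_c \det (relmx K (blockmap s c) (C c) (C c)) = 1 :> K.
Proof.
move=> ps pr.
pose t c := perm (blockmap_inj (pr c)).
have ton c : perm_on (val (C c)) (t c).
  apply/subsetP => x; rewrite inE permE /blockmap; case: ifP => [h _|_]; last by rewrite eqxx.
  exact: (subsetP (BC c)).
have es : s = (\prod_c t c)%g.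
  have H r : uniq r -> forall x, (\prod_(c <- r) t c)%g x =
      if has (fun c => x \in B c) r then s x else x.
    elim: r => [|c r IH] /=; first by move=> _ x; rewrite big_nil perm1.
    case/andP => cr ur x; rewrite big_cons permM {1}permE /blockmap IH //.
    case: (boolP (x \in B c)) => xB /=; last by [].
    rewrite ifN //; apply/hasPn => c' c'r; apply/negP => h.
    have sB : s x \in B c by rewrite -(pr c) imset_f.
    by move: cr; rewrite (mem_block_unique sB h) c'r.
  apply/permP => x; rewrite H ?index_enum_uniq //.
  case: hasP => // h; apply: (out_perm ps); apply/negP => /bigcupP[c _ xB].
  by apply: h; exists c => //; rewrite mem_index_enum.
have -> : \prod_c \det (relmx K (blockmap s c) (C c) (C c)) = \prod_c (-1) ^+ (t c) :> K.
  apply: eq_bigr => c _; rewrite -(relmx_perm K (ton c)); congr (\det _).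
  by apply/matrixP => p p'; rewrite !mxE permE.
have -> : \prod_c (-1) ^+ (t c) = (-1) ^+ s :> K.
  rewrite es; symmetry.
  apply: (big_morph (fun u : {perm 'I_n} => (-1) ^+ u : K)).
    by move=> u u'; rewrite odd_permM signr_addb.
  by rewrite odd_perm1.
by rewrite -expr2 sqrr_sign.
Qed.

End Shuffle.

(** * Complements and dual minors *)

Lemma compl_subproof q q' n (A : KSub q n) : (q + q' = n)%N -> #|~: val A| == q'.
Proof. by move=> e; rewrite cardsCs setCK card_KSub card_ord -e addKn. Qed.

Definition compl q q' n (e : (q + q' = n)%N) (A : KSub q n) : KSub q' n :=
  Sub (~: val A) (compl_subproof A e).

(* Both minors are read off the determinant of [V] stacked on the coordinate rows of [A]:
   multiply it by the permutation matrix of the columns, or by the inverse of [row_ebase V]. *)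
Lemma dual_minors (K : fieldType) k k' n (e : (k + k' = n)%N) (e' : (k' + k = n)%N) :
  exists eps : KSub k' n -> K, (forall A, eps A != 0) /\
  forall V : 'M[K]_(k, n), Gr V -> exists (U : 'M[K]_(k', n)) (x : K),
    [/\ x != 0, forall A, minor U A = x * eps A * minor V (compl e' A)
      & U *m V^T = 0].
Proof.
subst n.
pose P (A : KSub k' (k + k')) := row_mx (selmx K (compl e' A)) (selmx K A).
have P0 A : \det (P A) != 0 by apply: det_row_selmx; rewrite /= setCK.
exists (fun A => (\det (P A))^-1); split; first by move=> A; rewrite invr_eq0.
move=> V gV.
pose Q := invmx (row_ebase V).
pose L := col_ebase V.
have dQ : \det Q != 0 by rewrite -unitfE -[_ \is a _]/(_ \in unitmx) unitmx_inv row_ebase_unit.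
have dL : \det L != 0 by rewrite -unitfE -[_ \is a _]/(_ \in unitmx) col_ebase_unit.
have VQ : V *m Q = row_mx L 0.
  have := mulmx_ebase V; rewrite gV => {1}<-; rewrite -!mulmxA mulmxV ?row_ebase_unit // mulmx1.
  by rewrite pid_mx_row mul_mx_row mulmx1 mulmx0.
have VQ2 : V *m rsubmx Q = 0 by rewrite mulmx_rsub VQ row_mxKr.
exists (rsubmx Q)^T, (\det Q / \det L); split.
- by rewrite mulf_neq0 // invr_eq0.
- move=> A; pose M := col_mx V (selmx K A)^T.
  have MP : \det M * \det (P A) = minor V (compl e' A).
    rewrite -det_mulmx /P mul_col_row selmxK.
    rewrite selmx_disjoint // det_ublock det1 mulr1 minor_selmx.
    by [].
  have MQ : \det M * \det Q = \det L * minor (rsubmx Q)^T A.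
    rewrite -det_mulmx /M mul_col_mx VQ -[Q in LHS]hsubmxK mul_mx_row.
    rewrite -[col_mx _ _]/(block_mx _ _ _ _) det_lblock; congr (_ * _).
    by rewrite minor_selmx -det_tr trmx_mul trmxK.
  have -> : minor (rsubmx Q)^T A = (\det L)^-1 * (\det M * \det Q) by rewrite MQ mulKf.
  rewrite -MP [\det M * \det (P A)]mulrC [RHS]mulrA mulfVK //.
  by rewrite [\det Q / _]mulrC -mulrA [\det Q * _]mulrC.
- by rewrite -trmx_mul VQ2 trmx0.
Qed.

(** If some entry of [b] exceeded the corresponding entry [y] of [a], then [b] would have fewer
    elements up to [y], hence miss one of [a] there and gain one beyond [y]. *)
Lemma pleq_swap k n (a b : KSub k n) :
  (forall x z : 'I_n, x \in val b -> x \notin val a -> z \in val a -> z \notin val b -> (x < z)%N) ->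
  pleq b a.
Proof.
move=> h i; rewrite leqNgt; apply/negP => lt.
set y := nth 0%N (entries a) i in lt.
have ik := ltn_ord i.
have yn : (y < n)%N by rewrite (@entries_ltn _ _ a) // mem_nth // size_entries.
have cb := @cnt_le_index k n b i y.+1 yn lt.
have ca : (i < cnt (inA a) n (n + y.+1))%N.
  rewrite cnt_inA //.
  apply: leq_trans (_ : \sum_(p < k | (p < i.+1)%N) 1 <= _)%N.
    by rewrite -(big_ord_widen k (fun=> 1%N)) // sum1_card card_ord.
  rewrite big_mkcond; apply: leq_sum => p _; case: ltnP => //; rewrite ltnS => pi.
  suff -> : (nth 0%N (entries a) p < y.+1)%N by [].
  rewrite ltnS /y; have [->//|ne] := eqVneq (p : nat) i.
  by apply/ltnW/nth_entries_lt; rewrite ik andbT; lia.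
have cn (g : KSub k n) : cnt (inA g) n (n + y.+1) = #|[set x in val g | (x <= y)%N]|.
  rewrite cnt_inA // -sum1_card.
  under [RHS]eq_bigl => x do rewrite inE.
  rewrite big_colix [RHS]big_mkcond; apply: eq_bigr => p _ /=.
  by rewrite colixE ltnS; case: leqP.
have [z] : exists z, z \in [set x in val a | (x <= y)%N] :\: [set x in val b | (x <= y)%N].
  apply/set0Pn; rewrite -card_gt0 cardsD; rewrite !cn in ca cb.
  have := subset_leq_card (subsetIr [set x in val a | (x <= y)%N] [set x in val b | (x <= y)%N]).
  by lia.
rewrite !inE => /andP[zb /andP[za zy]]; rewrite zy andbT in zb.
have cC (g : KSub k n) : (#|[set x in val g | (x <= y)%N]| + #|[set x in val g | (y < x)%N]| = k)%N.
  rewrite -[RHS](card_KSub g) -(cardsID [set x : 'I_n | (x <= y)%N] (val g)).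
  congr addn; apply: eq_card => x; rewrite !inE // -ltnNge andbC //.
have [x] : exists x, x \in [set x in val b | (y < x)%N] :\: [set x in val a | (y < x)%N].
  apply/set0Pn; rewrite -card_gt0 cardsD; rewrite !cn in ca cb.
  have := subset_leq_card (subsetIr [set x in val b | (y < x)%N] [set x in val a | (y < x)%N]).
  by have := cC a; have := cC b; lia.
rewrite !inE => /andP[xa /andP[xb yx]]; rewrite yx andbT in xa.
by have := h x z xb xa za zb; lia.
Qed.

(** * Leading monomials of shuffle polynomials *)

Section ShufflePoly.
Variables (K : fieldType) (k n q d : nat).
Hypothesis charK0 : [pchar K] =i pred0.
Variable rk : KSub k n -> nat.
Hypothesis hrk : lin_ext rk.

Definition chainm (T : 'I_d -> KSub k n) : 'X_{1..N k n} :=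
  (\sum_(i < d) U_(enum_rank (T i)))%MM.

Lemma chainmE T i : chainm T i = #|[set c | enum_rank (T c) == i]|.
Proof.
rewrite /chainm mnm_sumE -[RHS]sum1_card [RHS]big_mkcond /=; apply: eq_bigr => c _.
by rewrite mnm1E inE; case: eqP.
Qed.

(** Since [T] is a chain, the lowest ranked [b c] with [c0 <= c] is below every [T c] with
    [c0 <= c]; it is the lowest variable whose exponents differ, and its exponent is larger in
    [b]. *)
Lemma grevlex_chain (T b : 'I_d -> KSub k n) (c0 : 'I_d) : ssyt T ->
  (forall c : 'I_d, (c < c0)%N -> b c = T c) -> (rk (b c0) < rk (T c0))%N ->
  grevlex_gt rk (chainm T) (chainm b).
Proof.
move=> sT lo lt; right; split.
  by rewrite /chainm !mdeg_sum; apply: eq_bigr => c _; rewrite !mdeg1.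
pose c1 := [arg min_(c < c0 | (c0 <= c)%N) rk (b c)].
have [h01 hmin] : (c0 <= c1)%N /\ forall c : 'I_d, (c0 <= c)%N -> (rk (b c1) <= rk (b c))%N.
  by rewrite /c1; case: arg_minnP => // c.
have lt1 (c : 'I_d) : (c0 <= c)%N -> (rk (b c1) < rk (T c))%N.
  move=> h; apply: leq_trans (hrk.2 _ _ (sT c0 c h)).
  by apply: leq_ltn_trans lt; apply: hmin.
exists (enum_rank (b c1)); split.
  rewrite !chainmE; apply: proper_card; apply/properP; split.
    apply/subsetP => c; rewrite !inE => /eqP/enum_rank_inj e.
    case: (ltnP c c0) => h; first by rewrite lo // e.
    by have := lt1 c h; rewrite e ltnn.
  exists c1; rewrite inE // ; apply/negP => /eqP/enum_rank_inj e.
  by have := lt1 c1 h01; rewrite e ltnn.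
move=> w; rewrite enum_rankK => hw; rewrite !chainmE; apply: eq_card => c; rewrite !inE.
case: (ltnP c c0) => h; first by rewrite lo.
apply/eqP/eqP => e; exfalso.
  by have := lt1 c h; move: hw; rewrite -e enum_rankK; lia.
by have := hmin c h; move: hw; rewrite -e enum_rankK; lia.
Qed.

Lemma grevlex_irr (m : 'X_{1..N k n}) : ~ grevlex_gt rk m m.
Proof. by case=> [|[_ [v []]]]; rewrite ltnn. Qed.

Variables (T : 'I_d -> KSub k n) (C : 'I_d -> KSub q n) (B : 'I_d -> {set 'I_n}).
Variables (Phi : KSub q n -> KSub k n) (eps : KSub q n -> K).
Hypothesis sT : ssyt T.
Hypothesis BC : forall c, B c \subset val (C c).
Hypothesis Bdisj : forall c c', c != c' -> [disjoint B c & B c'].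
Hypothesis Phi_inj : injective Phi.
Hypothesis PhiC : forall c, Phi (C c) = T c.
Hypothesis eps0 : forall A, eps A != 0.
Hypothesis Phi_order : forall (c : 'I_d) (A : KSub q n),
  (forall x, x \in val A -> x \notin val (C c) -> exists2 c' : 'I_d, (c < c')%N & x \in B c') ->
  (forall z, z \in val (C c) -> z \notin val A -> z \in B c) -> pleq (Phi A) (T c).

Let Bu := \bigcup_c B c.

(** The default [C c] is taken only when images collide; [goodperm] excludes this case, where a
    determinant vanishes. *)
Definition blockimg s c : KSub q n := insubd (C c) (blockmap B s c @: val (C c)).
Definition goodperm (s : {perm 'I_n}) :=
  perm_on Bu s && [forall c, #|blockmap B s c @: val (C c)| == q].
Definition shuffle_coef (s : {perm 'I_n}) : K := (-1) ^+ s *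
  \prod_c (\det (relmx K (blockmap B s c) (C c) (blockimg s c)) * eps (blockimg s c)).
(** [Phi] and [eps] translate minors of [U] into Plücker coordinates of [V]: the identity and 1 if
    the interval does not wrap, the complement and the constants of [dual_minors] if it does. *)
Definition shuffle_poly : {mpoly K[N k n]} :=
  \sum_(s | goodperm s) shuffle_coef s *: 'X_[chainm (fun c => Phi (blockimg s c))].

Lemma val_blockimg s c : goodperm s -> val (blockimg s c) = blockmap B s c @: val (C c).
Proof. by case/andP => _ /forallP/(_ c) h; rewrite val_insubd h. Qed.

Lemma meval_chainm (V : 'M[K]_(k, n)) b : meval (plucker V) 'X_[chainm b] = \prod_c minor V (b c).
Proof.
rewrite /chainm -mprodXE rmorph_prod; apply: eq_bigr => c _ /=.
by rewrite mevalXU /plucker enum_rankK.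
Qed.

Lemma shuffle_poly_vanish (V : 'M[K]_(k, n)) (U : 'M[K]_(q, n)) x (lam : 'cV[K]_n) :
  x != 0 -> (forall A, minor U A = x * eps A * minor V (Phi A)) ->
  U *m lam = 0 -> lam != 0 -> (forall j, j \notin Bu -> lam j 0 = 0) ->
  meval (plucker V) shuffle_poly = 0.
Proof.
move=> x0 hU Ul lam0 lamB.
apply: (mulfI (expf_neq0 d x0)); rewrite mulr0 -(shuffle_vanish BC Bdisj Ul lam0 lamB).
rewrite raddf_sum mulr_sumr /= -/Bu.
rewrite [RHS](bigID (fun s : {perm 'I_n} => [forall c, #|blockmap B s c @: val (C c)| == q])) /=.
rewrite [X in _ = _ + X]big1 ?addr0; last first.
  move=> s /andP[_ /forallPn[c hc]].
  by rewrite (bigD1 c) //= subdet_small // mul0r mulr0.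
apply: eq_bigr => s gs; rewrite mevalZ meval_chainm /shuffle_coef.
rewrite mulrCA -!mulrA; congr (_ * _).
rewrite -[X in x ^+ X]card_ord -prodr_const -!big_split; apply: eq_bigr => c _ /=.
rewrite (@subdet_rel _ _ _ U _ (C c) (blockimg s c)); last by rewrite (val_blockimg _ gs).
rewrite hU; set D := \det _; set m := minor _ _; set e := eps _.
by rewrite -!mulrA mulrC -!mulrA mulrCA; do 2!congr (_ * _).
Qed.

Let preserved (s : {perm 'I_n}) := [forall c, s @: B c == B c].

Lemma blockimg_id s c : goodperm s -> s @: B c = B c -> blockimg s c = C c.
Proof.
move=> gs e; apply: val_inj; rewrite val_blockimg //; apply/eqP.
rewrite eqEcard card_imset ?leqnn ?andbT; last exact: blockmap_inj.
apply/subsetP => x /imsetP[y yC ->]; rewrite /blockmap; case: ifP => // yB.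
by apply: (subsetP (BC c)); rewrite -e imset_f.
Qed.

Lemma shuffle_preserved s : goodperm s -> preserved s ->
  chainm (fun c => Phi (blockimg s c)) = chainm T /\ shuffle_coef s = \prod_c eps (C c).
Proof.
move=> gs /forallP pr.
have e c : blockimg s c = C c by apply: blockimg_id => //; apply/eqP.
split; first by rewrite /chainm; apply: eq_bigr => c _; rewrite e PhiC.
rewrite /shuffle_coef; under eq_bigr => c _ do rewrite e.
rewrite big_split /= mulrA preserved_sign ?mul1r //; first by case/andP: gs.
by move=> c; apply/eqP.
Qed.

Lemma shuffle_moved s : goodperm s -> ~~ preserved s ->
  grevlex_gt rk (chainm T) (chainm (fun c => Phi (blockimg s c))).
Proof.
move=> gs /forallPn[c hc].
pose c0 := [arg min_(c' < c | s @: B c' != B c') (c' : nat)].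
have [h0 hmin] : s @: B c0 != B c0 /\ forall c' : 'I_d, (c' < c0)%N -> s @: B c' = B c'.
  rewrite /c0; case: arg_minnP => // c1 h1 h2; split=> // c' lt.
  by apply/eqP; apply: contraLR lt => /h2; rewrite -leqNgt.
have ps : perm_on Bu s by case/andP: gs.
have cd : #|blockmap B s c0 @: val (C c0)| = q by case/andP: gs => _ /forallP/(_ c0)/eqP.
have [m1 m2 m3] := first_moved_block BC Bdisj ps hmin h0 cd.
rewrite -(val_blockimg c0 gs) in m1 m2 m3.
apply: (@grevlex_chain T _ c0) => //.
  by move=> c' lt; rewrite blockimg_id ?PhiC ?hmin.
have ple := Phi_order m2 m3.
rewrite ltn_neqAle hrk.2 // andbT; apply: contra m1 => /eqP/hrk.1.
by rewrite -PhiC => /Phi_inj ->.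
Qed.

(** Permutations preserving all blocks contribute the monomial of [T] with one and the same
    coefficient, and do not cancel in characteristic 0; the others give smaller monomials. *)
Lemma shuffle_lead : is_lead rk shuffle_poly (chainm T).
Proof.
split.
  rewrite mcoeff_msupp raddf_sum /= (bigID preserved) /= [X in _ + X]big1 ?addr0.
    rewrite (eq_bigr (fun=> \prod_c eps (C c))); last first.
      move=> s /andP[gs pr]; have [-> ->] := shuffle_preserved gs pr.
      by rewrite mcoeffZ mcoeffX eqxx mulr1.
    rewrite sumr_const -mulr_natr mulf_neq0 //; first by apply/prodf_neq0.
    rewrite (proj1 (pcharf0P K) charK0) -lt0n; apply/card_gt0P; exists 1%g.
    have i1 c : (perm_one _ : {perm 'I_n}) @: B c = B c.
      by rewrite -[RHS]imset_id; apply: eq_imset => x; rewrite perm1.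
    rewrite unfold_in /goodperm perm_on1 /=; apply/andP; split; apply/forallP => c.
      rewrite card_imset ?card_KSub //; apply: blockmap_inj; exact: i1.
    by apply/eqP; exact: i1.
  move=> s /andP[gs pr]; rewrite mcoeffZ mcoeffX; case: eqP => [e|]; last by rewrite mulr0.
  by have := shuffle_moved gs pr; rewrite e => /grevlex_irr.
move=> m; rewrite mcoeff_msupp raddf_sum /= => h ne.
have [s gs hs] : exists2 s, goodperm s & (shuffle_coef s *: 'X_[chainm (fun c => Phi (blockimg s c))])@_m != 0.
  apply/exists_inP; apply: contraR h => /exists_inPn h; rewrite big1 // => s /h.
  by rewrite negbK => /eqP.
move: hs; rewrite mcoeffZ mcoeffX; case: (_ =P m) => [e _|]; last by rewrite mulr0 eqxx.
rewrite -e; apply: shuffle_moved => //; apply/negP => pr.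
by have [e' _] := shuffle_preserved gs pr; rewrite -e e' eqxx in ne.
Qed.

End ShufflePoly.

(** * Basic positroid varieties *)

Section Columns.
Variables (K : fieldType) (k n : nat).
Hypothesis n_gt0 : (0 < n)%N.
Implicit Types (V : 'M[K]_(k, n)) (v : nat -> 'rV[K]_k).

Definition colseq V (z : nat) : 'rV[K]_k := colv V z%:Z.

Lemma colseqE V z : colseq V z = \row_r V r (Ordinal (ltn_pmod z n_gt0)).
Proof.
apply/rowP => r; rewrite !mxE (big_pred1 (Ordinal (ltn_pmod z n_gt0))) // => j /=.
by rewrite modz_nat eqz_nat -(inj_eq val_inj).
Qed.

Lemma colseq_congr V z z' : (z = z' %[mod n])%N -> colseq V z = colseq V z'.
Proof.
move=> e; rewrite !colseqE; apply/rowP => r; rewrite !mxE; congr (V r _); exact: val_inj.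
Qed.

Lemma colseq_ord V (j : 'I_n) r : colseq V j 0 r = V r j.
Proof. by rewrite colseqE mxE; congr (V r _); apply: val_inj; rewrite /= modn_small. Qed.

Lemma colseq_shift V z : colseq V (z + n) = colseq V z.
Proof. by apply: colseq_congr; rewrite modnDr. Qed.

Lemma periodic_mod v z : (forall z, v (z + n)%N = v z) -> v (z %% n)%N = v z.
Proof.
move=> pv; rewrite [in RHS](divn_eq z n) addnC.
by elim: (z %/ n)%N => [|m IH]; rewrite ?addn0 // mulSnr addnA pv.
Qed.

Lemma colseq_mat v z : (forall z, v (z + n)%N = v z) -> colseq (mat n v) z = v z.
Proof. by move=> pv; apply/rowP => r; rewrite colseqE !mxE /= periodic_mod. Qed.

Lemma Xbasic_interval alpha m r : (m <= n)%N ->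
  exists x y, [/\ (n <= y < n + n)%N, (x <= y <= x + n)%N &
    forall V, Xbasic alpha m r V <-> Gr V /\ (irk (colseq V) x y <= r)%N].
Proof.
(* [y] is the exclusive right end [alpha + m + 1] moved into the home window; the interval wraps
   exactly when [y - m < n]. *)
move=> mn; pose y := (n + (alpha + m.+1) %% n)%N.
have hy : ((alpha + m.+1) %% n < n)%N by rewrite ltn_mod.
have ym : (y - m + m = y)%N by rewrite subnK // /y; lia.
have cong s : (alpha + s.+1 = (y - m) + s %[mod n])%N.
  apply/eqP; rewrite -(eqn_modDr m).
  have -> : (y - m + s + m = y + s)%N by lia.
  have -> : (alpha + s.+1 + m = alpha + m.+1 + s)%N by lia.
  by rewrite /y -[(n + _ + s)%N]addnA modnDl modnDml.
exists (y - m)%N, y; split; [by rewrite /y; lia|by lia|] => V.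
suff -> : irk (colseq V) (y - m) y = \rank (\sum_(s < m) <<colv V (alpha + s.+1)%:Z>>)%MS by [].
apply/eqmx_rank/andP; split.
  apply: ispan_sub => z h1 h2.
  have zm : (z - (y - m) < m)%N by lia.
  apply: (sumsmx_sup (Ordinal zm)) => //=; rewrite genmxE.
  rewrite -/(colseq V _) (colseq_congr V (cong (z - (y - m))%N)) subnKC //.
apply/sumsmx_subP => s _; rewrite genmxE -/(colseq V _) (colseq_congr V (cong s)).
by apply: mem_ispan; have := ltn_ord s; lia.
Qed.

Lemma irk_scale v c x y : c != 0 -> irk (fun z => c *: v z) x y = irk v x y.
Proof.
move=> c0; rewrite /irk /ispan; congr (\rank _); apply: eq_bigr => z _.
by apply/genmxP/eqmxP/eqmx_scale.
Qed.

End Columns.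

Lemma cnt_card k n (a : KSub k n) x y : (n <= x)%N -> (y <= n + n)%N ->
  cnt (inA a) x y = #|[set j in val a | (x <= j + n < y)%N]|.
Proof.
move=> nx yn; rewrite /cnt (big_nat_widenl _ n) // (big_nat_widen _ _ (n + n)) //=.
rewrite -{1}[n]add0n big_addn addnK big_mkord -sum1_card.
rewrite big_mkcond [RHS]big_mkcond; apply: eq_bigr => j _ /=.
rewrite inE addnC inA_shift inA_small // mem_entries.
by case: (j \in val a); case: ifP.
Qed.

Lemma card_interval n x y : (n <= x <= y)%N -> (y <= n + n)%N ->
  #|[set j : 'I_n | (x <= j + n < y)%N]| = (y - x)%N.
Proof.
move=> nx yn; rewrite -sum1_card.
have -> : (y - x = \sum_(x <= z < y) 1)%N by rewrite sum_nat_const_nat muln1.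
rewrite (big_nat_widenl _ n); last by lia.
rewrite (big_nat_widen _ _ (n + n)) //= -[X in \sum_(X <= _ < _ | _) _]add0n big_addn addnK big_mkord.
by apply: eq_bigl => j; rewrite inE.
Qed.

(** * Linear relations among columns *)

Section Dependency.
Variables (K : fieldType) (k n : nat).
Hypothesis n_gt0 : (0 < n)%N.
Implicit Types (V : 'M[K]_(k, n)) (S : {set 'I_n}).

Definition setK S : KSub #|S| n := exist _ S (eqxx #|S|).

Lemma rank_columns V S m (W : 'M[K]_(m, k)) :
  (forall j, j \in S -> (colseq V j <= W)%MS) -> (\rank (V *m selmx K (setK S)) <= \rank W)%N.
Proof.
move=> h; rewrite -mxrank_tr; apply/mxrankS/row_subP => p.
have -> : row p (V *m selmx K (setK S))^T = colseq V (colix (setK S) p).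
  by apply/rowP => r; rewrite 2!mxE mul_selmx colseq_ord.
by apply: h; exact: (colix_mem (setK S) p).
Qed.

Lemma dependent_columns V S : (\rank (V *m selmx K (setK S)) < #|S|)%N ->
  exists lam : 'cV[K]_n, [/\ V *m lam = 0, lam != 0 & forall j, j \notin S -> lam j 0 = 0].
Proof.
set W := V *m _ => lt.
have : kermx W^T != 0.
  rewrite kermx_eq0 /row_free mxrank_tr; by apply/eqP => e; rewrite e ltnn in lt.
case/rowV0Pn => mu /sub_kermxP mW mu0.
have Wm : W *m mu^T = 0 by rewrite -[W]trmxK -trmx_mul mW trmx0.
exists (selmx K (setK S) *m mu^T); split; first by rewrite mulmxA.
  apply: contra mu0 => /eqP e; have := congr1 (mulmx (selmx K (setK S))^T) e.
  by rewrite mulmxA selmxK mul1mx mulmx0 => /eqP; rewrite trmx_eq0.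
move=> j jS; rewrite mxE big1 // => p _; rewrite mxE; case: eqP => [e|]; last by rewrite mul0r.
by have := colix_mem (setK S) p; rewrite -e (negbTE jS).
Qed.

(** A dual matrix kills the row space of [V], so [mu *m V] is a relation among its columns in
    [S]. *)
Lemma supported_row V S : Gr V -> (\rank (V *m selmx K (setK (~: S))) < k)%N ->
  exists mu : 'rV[K]_k, mu *m V != 0 /\ forall j, j \notin S -> (mu *m V) 0 j = 0.
Proof.
set W := V *m _ => gV lt.
have : kermx W != 0.
  by rewrite kermx_eq0 /row_free; apply/eqP => e; rewrite e ltnn in lt.
case/rowV0Pn => mu /sub_kermxP mW mu0; exists mu; split.
  apply: contra mu0 => /eqP e.
  have rf : row_free V by rewrite /row_free gV.
  by apply/eqP/(row_free_inj rf); rewrite e mul0mx.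
move=> j jS; have [p ->] : exists p, j = colix (setK (~: S)) p.
  by apply: colixP; rewrite /= inE.
by rewrite -mul_selmx -mulmxA mW mxE.
Qed.

End Dependency.

(** * Vanishing polynomials with given leading monomial *)

Section Basic.
Variables (K : fieldType) (k n d : nat).
Hypothesis charK0 : [pchar K] =i pred0.
Hypothesis n_gt0 : (0 < n)%N.
Variable rk : KSub k n -> nat.
Hypothesis hrk : lin_ext rk.
Variable T : 'I_d -> KSub k n.
Hypothesis sT : ssyt T.

Definition lead_vanishing (X : 'M[K]_(k, n) -> Prop) := exists p,
  (forall V, X V -> meval (plucker V) p = 0) /\ is_lead rk p (chainm T).

Lemma antitone_iter (g : nat -> nat) : (forall c, (g c.+1 <= g c)%N) ->
  forall c c', (c <= c')%N -> (g c' <= g c)%N.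
Proof.
by move=> h c c' /subnKC <-; elim: (c' - c)%N => [|e IH]; rewrite ?addn0 // addnS (leq_trans (h _)).
Qed.

Lemma monotone_iter (g : nat -> nat) : (forall c, (g c <= g c.+1)%N) ->
  forall c c', (c <= c')%N -> (g c <= g c')%N.
Proof.
by move=> h c c' /subnKC <-; elim: (c' - c)%N => [|e IH]; rewrite ?addn0 // addnS (leq_trans IH).
Qed.

Lemma card_disjoint_blocks (B : 'I_d -> {set 'I_n}) :
  (forall c c', c != c' -> [disjoint B c & B c']) ->
  #|\bigcup_c B c| = (\sum_c #|B c|)%N.
Proof.
move=> dB; rewrite -sum1_card (@partition_disjoint_bigcup _ _ _ _ _ B _ dB).
by apply: eq_bigr => c _; rewrite sum1_card.
Qed.

(** The thresholds cut out blocks of more than [r] columns of the interval, hence dependent ones;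
    the first moved column trades entries of its block for entries of later blocks, which lie
    further left. *)
Lemma lead_nonwrap r x y (g : nat -> nat) : (n <= x <= y)%N -> (y <= n + n)%N ->
  g 0%N = y -> (forall c, (g c.+1 <= g c)%N) -> (forall c, (x <= g c)%N) ->
  (r < \sum_(c < d) cnt (inA (T c)) (g c.+1) (g c))%N ->
  lead_vanishing (fun V => Gr V /\ (irk (colseq V) x y <= r)%N).
Proof.
move=> xy yn g0 gS gx hr.
have gm := antitone_iter gS.
pose B (c : 'I_d) := [set j in val (T c) | (g c.+1 <= j + n < g c)%N].
have dB c c' : c != c' -> [disjoint B c & B c'].
  move=> ne; apply/pred0P => j /=; apply/negbTE/negP; rewrite !inE => /andP[/andP[_ h1] /andP[_ h2]].
  have [lt|lt] : (c < c')%N \/ (c' < c)%N by move: ne; rewrite -(inj_eq val_inj) /=; lia.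
    by have := gm _ _ lt; lia.
  by have := gm _ _ lt; lia.
have BC c : B c \subset val (T c) by apply/subsetP => j; rewrite inE => /andP[].
have cB : #|\bigcup_c B c| = (\sum_(c < d) cnt (inA (T c)) (g c.+1) (g c))%N.
  rewrite card_disjoint_blocks //; apply: eq_bigr => c _.
  rewrite cnt_card //; first by have := gx c.+1; lia.
  by have := gm 0%N c (leq0n _); lia.
exists (shuffle_poly T B id (fun=> 1)); split; last first.
  apply: shuffle_lead => //; first by move=> A; exact: oner_neq0.
  move=> c A h1 h2; apply: pleq_swap => j z jA jT zT zA.
  have [c' lt] := h1 j jA jT; rewrite inE => /andP[_ hj].
  have := h2 z zT zA; rewrite inE => /andP[_ hz].
  by have := gm _ _ lt; lia.
move=> V [gV rV].
have [|lam [l1 l2 l3]] := @dependent_columns K k n V (\bigcup_c B c).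
  rewrite -cB in hr; apply: leq_ltn_trans hr; apply: leq_trans rV.
  apply: rank_columns => // j /bigcupP[c _]; rewrite inE => /andP[_ hj].
  rewrite -(colseq_shift n_gt0); apply: mem_ispan; first by have := gx c.+1; lia.
  by have := gm 0%N c (leq0n _); lia.
apply: (@shuffle_poly_vanish _ _ _ _ _ T B id (fun=> 1) BC dB V V 1 lam) => //.
  exact: oner_neq0.
by move=> A; rewrite !mul1r.
Qed.

(** The blocks lie in the complements [C c], further right as [c] grows: the first moved complement
    gains larger elements, so its column becomes smaller. *)
Lemma lead_wrap r x y (g : nat -> nat) : (x < n)%N -> (n <= y <= x + n)%N ->
  g 0%N = y -> (forall c, (g c <= g c.+1)%N) -> (forall c, (g c <= x + n)%N) -> g d = (x + n)%N ->
  (r + \sum_(c < d) cnt (inA (T c)) (g c) (g c.+1) < k)%N -> (k <= n)%N ->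
  lead_vanishing (fun V => Gr V /\ (irk (colseq V) x y <= r)%N).
Proof.
move=> xn xy g0 gS gx gd hr kn.
have gm := monotone_iter gS.
have e : (k + (n - k) = n)%N by lia.
have e' : ((n - k) + k = n)%N by lia.
have [eps [eps0 dual]] := @dual_minors K k (n - k) n e e'.
pose C c := compl e (T c).
pose B (c : 'I_d) := [set j in val (C c) | (g c <= j + n < g c.+1)%N].
have dB c c' : c != c' -> [disjoint B c & B c'].
  move=> ne; apply/pred0P => j /=; apply/negbTE/negP; rewrite !inE => /andP[/andP[_ h1] /andP[_ h2]].
  have [lt|lt] : (c < c')%N \/ (c' < c)%N by move: ne; rewrite -(inj_eq val_inj) /=; lia.
    by have := gm _ _ lt; lia.
  by have := gm _ _ lt; lia.
have BC c : B c \subset val (C c) by apply/subsetP => j; rewrite inE => /andP[].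
have gy c : (y <= g c)%N by rewrite -g0; apply: gm.
have cB1 (c : 'I_d) : (#|B c| + cnt (inA (T c)) (g c) (g c.+1) = g c.+1 - g c)%N.
  have := gy c; have := gx c.+1; have := gS c => h1 h2 h3.
  rewrite cnt_card; [|lia..].
  rewrite -(@card_interval n (g c) (g c.+1)); [|lia..].
  rewrite -[RHS](cardsID (val (T c))) addnC; congr addn; apply: eq_card => j.
    by rewrite !inE andbC.
  by rewrite !inE.
have tel : (\sum_(c < d) (g c.+1 - g c) = x + n - y)%N.
  rewrite -gd -g0; elim: d => [|d' IH]; first by rewrite big_ord0 subnn.
  rewrite big_ord_recr /= IH; have := gS d'; have := gm 0%N d' (leq0n _); lia.
have cB : (#|\bigcup_c B c| + \sum_(c < d) cnt (inA (T c)) (g c) (g c.+1) = x + n - y)%N.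
  by rewrite card_disjoint_blocks // -big_split -tel; apply: eq_bigr => c _; exact: cB1.
exists (shuffle_poly C B (compl e') eps); split; last first.
  apply: (shuffle_lead charK0 hrk sT BC dB) => //.
  - move=> A A' /(congr1 val)/= h; apply: val_inj => /=.
    by rewrite -[LHS]setCK h setCK.
  - by move=> c; apply: val_inj; rewrite /= setCK.
  move=> c A h1 h2; apply: pleq_swap => j z /=; rewrite !inE negbK => jA jT zT zA.
  have := h2 j; rewrite /= !inE => /(_ jT jA)/andP[_ hj].
  have := h1 z zA; rewrite /= !inE negbK => /(_ zT)[c' lt]; rewrite inE => /andP[_ hz].
  by have := gm _ _ lt; lia.
move=> V [gV rV].
(* [W] has as many elements as the sum of the counts in [hr]. Columns outside the blocks lie in the
   interval or in [W], so their rank is at most [r + #|W| < k]. *)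
pose W := [set j : 'I_n | (y <= j + n < x + n)%N] :\: \bigcup_c B c.
have cW : (#|W| + #|\bigcup_c B c| = x + n - y)%N.
  rewrite -(@card_interval n y (x + n)); [|lia..].
  rewrite -[RHS](cardsID (\bigcup_c B c)) addnC; congr addn; apply: eq_card => j.
  rewrite inE andbC; case: (boolP (j \in _)) => //= /bigcupP[c _]; rewrite !inE => /andP[_ hj].
  by have := gy c; have := gx c.+1; lia.
have [|mu [m1 m2]] := @supported_row K k n V (\bigcup_c B c) gV.
  apply: leq_ltn_trans (_ : _ <= \rank (ispan (colseq V) x y + \sum_(j in W) <<colseq V j>>)%MS)%N _.
    apply: rank_columns => // j; rewrite inE => jB.
    case: (boolP (y <= j + n < x + n)%N) => hj.
      apply: submx_trans (addsmxSr _ _).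
      by apply: (sumsmx_sup j); rewrite ?genmxE // !inE jB.
    apply: submx_trans (addsmxSl _ _).
    have jn := ltn_ord j.
    have [jy|yj] := ltnP (j + n) y; last by apply: mem_ispan; lia.
    by rewrite -(colseq_shift n_gt0); apply: mem_ispan; lia.
  apply: leq_ltn_trans (mxrank_adds_leqif _ _) _.
  apply: leq_ltn_trans (_ : _ <= r + #|W|)%N _; last by lia.
  apply: leq_add => //.
  apply: leq_trans (mxrank_sum_leqif _) _.
  rewrite -sum1_card; apply: leq_sum => j _ /=; rewrite genmxE; exact: rank_leq_row.
have [U [c [c0 hU UV]]] := dual V gV.
apply: (@shuffle_poly_vanish _ _ _ _ _ C B (compl e') eps BC dB V U c (mu *m V)^T) => //.
- by rewrite trmx_mul mulmxA UV mul0mx.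
- by rewrite trmx_eq0.
- by move=> j /m2 h; rewrite mxE.
Qed.

End Basic.

(** * Initial ideals and the comparison *)

Section Initial.
Variables (K : fieldType) (k n : nat).
Hypothesis charK0 : [pchar K] =i pred0.
Hypothesis k_gt0 : (0 < k)%N.
Hypothesis kn : (k <= n)%N.
Variable rk : KSub k n -> nat.
Hypothesis hrk : lin_ext rk.
Implicit Types (p : {mpoly K[N k n]}) (m M : 'X_{1..N k n}) (J : {mpoly K[N k n]} -> Prop).

Lemma tab_monomialE d (T : 'I_d -> KSub k n) : tab_monomial K T = 'X_[chainm T].
Proof. by rewrite /tab_monomial mprodXE. Qed.

Lemma in_initial_lead J p m : J p -> is_lead rk p m -> in_initial rk J 'X_[m].
Proof.
move=> Jp lp; exists 1%N, (fun=> 1), (fun=> 'X_[m]); split; first by exists p, m.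
by rewrite big_ord1 mul1r.
Qed.

Lemma in_initial_mono J J' x : (forall p, J p -> J' p) -> in_initial rk J x -> in_initial rk J' x.
Proof.
move=> sub [l [q [g [hg e]]]]; exists l, q, g; split=> // t.
by have [p [m [h1 h2 h3]]] := hg t; exists p, m; split=> //; apply: sub.
Qed.

Lemma in_initial_dvd J M : in_initial rk J 'X_[M] ->
  exists p m D, [/\ J p, is_lead rk p m & M = (m + D)%MM].
Proof.
case=> l [q [g [hg e]]].
have [t ht] : exists t, (q t * g t)@_M != 0.
  apply/existsP; apply: contraT => /existsPn h.
  have := congr1 (mcoeff M) e; rewrite mcoeffX eqxx raddf_sum /= big1.
    by move/eqP; rewrite oner_eq0.
  by move=> t _; apply/eqP; have := h t; rewrite negbK.
have [p [m [Jp lp em]]] := hg t; exists p, m.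
move: ht; rewrite em -mcoeff_msupp (perm_mem (msuppMX _ _)) => /mapP[D _ eM].
by exists D.
Qed.

Lemma plucker_scale c (V : 'M[K]_(k, n)) i : plucker (c *: V) i = c ^+ k * plucker V i.
Proof.
rewrite /plucker !minorE -detZ; congr (\det _); apply/matrixP => r j.
by rewrite !mxE.
Qed.

Lemma monomial_scale c (V : 'M[K]_(k, n)) m :
  \prod_i plucker (c *: V) i ^+ m i = c ^+ (k * mdeg m) * \prod_i plucker V i ^+ m i.
Proof.
under eq_bigr => i _ do rewrite plucker_scale exprMn -exprM.
rewrite big_split /= -expr_sum; congr (_ ^+ _ * _).
by rewrite mdegE -big_distrr.
Qed.

(** The value at [c *: V] is a polynomial in [c]; as [0 < k], distinct degrees give distinct powers
    of [c], so one coefficient is nonzero. This handles inhomogeneous [p]. *)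
Lemma homogeneous_part_neq0 p e (V : 'M[K]_(k, n)) :
  \sum_(m <- msupp p | mdeg m == e) p@_m * \prod_i plucker V i ^+ m i != 0 ->
  exists2 c, c != 0 & meval (plucker (c *: V)) p != 0.
Proof.
move=> h.
pose Q : {poly K} := \sum_(m <- msupp p) (p@_m * \prod_i plucker V i ^+ m i) *: 'X^(k * mdeg m).
have Qe : Q`_(k * e) = \sum_(m <- msupp p | mdeg m == e) p@_m * \prod_i plucker V i ^+ m i.
  rewrite coef_sum [RHS]big_mkcond; apply: eq_bigr => m _.
  rewrite coefZ coefXn eqn_pmul2l // eq_sym; case: eqP => _; rewrite ?mulr1 ?mulr0 //.
have Q0 : Q != 0 by apply: contra h => /eqP z; rewrite -Qe z coef0.
have [c c0 hc] := nonroot_neq0 charK0 Q0; exists c => //.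
rewrite mevalE; move: hc; rewrite horner_sum.
under eq_bigr => m _ do rewrite hornerZ hornerXn -mulrA [X in _ * X]mulrC -monomial_scale.
by [].
Qed.

Section Point.
Variables (d : nat) (T : 'I_d.+1 -> KSub k n).
Hypothesis sT : ssyt T.

Let Tn i := T (inord i).

Lemma tabm_chainm : tabm d.+1 Tn = chainm T.
Proof. by rewrite /tabm /chainm; apply: eq_bigr => i _; rewrite /Tn inord_val. Qed.

(** The family is the homogeneous part of [p] in degree [mdeg m], multiplied by the monomial [D]. *)
Lemma lead_family_lead p m D : is_lead rk p m -> chainm T = (m + D)%MM ->
  lead_family rk (chainm T) [seq (m' + D)%MM | m' <- msupp p & mdeg m' == mdeg m]
    (fun m' => p@_(m' - D)).
Proof.
move=> [ms lp] ->; split.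
- by rewrite map_inj_uniq ?filter_uniq ?msupp_uniq //; exact: addIm.
- by apply/mapP; exists m; rewrite ?mem_filter ?eqxx.
- by rewrite addmK -mcoeff_msupp.
- by move=> m1 /mapP[m2]; rewrite mem_filter => /andP[/eqP e _] ->; rewrite !mdegD e.
- move=> m1 /mapP[m2]; rewrite mem_filter => /andP[/eqP e m2s] ->.
  rewrite eqm_add2r => ne; case: (lp _ m2s ne) => [|[_ [v [h1 h2]]]]; first by rewrite e ltnn.
  right; split; first by rewrite !mdegD e.
  exists v; split; first by rewrite !mnmDE ltn_add2r.
  by move=> w /h2 h; rewrite !mnmDE h.
Qed.

Lemma standard_lead_point p m D : is_lead rk p m -> chainm T = (m + D)%MM ->
  exists v, [/\ forall z, v (z + n)%N = v z, Gr (mat n v : 'M[K]_(k, n)),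
    exists2 c, c != 0 & meval (plucker (c *: mat n v)) p != 0,
    boundN d Tn v & boundW d Tn v].
Proof.
move=> lp eM; have n_gt0 : (0 < n)%N by apply: leq_trans kn.
have := lead_family_lead lp eM; rewrite -{1}tabm_chainm => lf.
have [|v [pv piv ev bN bW]] := standard_point charK0 n_gt0 hrk _ lf.
  move=> i j hij; apply: sT; rewrite !inordK; lia.
exists v; split=> //.
  by apply: Gr_mat => //; rewrite piv ?cnt_inA_full //; lia.
apply: (@homogeneous_part_neq0 p (mdeg m)); apply: contra ev => /eqP h.
rewrite /evalm big_map big_filter.
under eq_bigr => m' _.
  rewrite addmK; under eq_bigr => i _ do rewrite mnmDE exprD.
  rewrite big_split /= mulrA.
  over.
by rewrite -mulr_suml h mul0r.
Qed.

(** If the rank of [v] on the defining interval exceeds [r], the thresholds bounding this rank yield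
    a shuffle polynomial. *)
Lemma basic_lead_or_point (v : nat -> 'rV[K]_k) (P : 'M[K]_(k, n) -> Prop) c :
  (forall z, v (z + n)%N = v z) -> Gr (mat n v : 'M[K]_(k, n)) ->
  boundN d Tn v -> boundW d Tn v -> c != 0 -> is_basic P ->
  P (c *: mat n v) \/ lead_vanishing rk T P.
Proof.
move=> pv gv bN bW c0 [alpha [m [r [/andP[m0 mn] hP]]]].
have n_gt0 : (0 < n)%N by apply: leq_trans mn.
have [x [y [hy hx hX]]] := Xbasic_interval K k n_gt0 alpha r mn.
have Tc (i : 'I_d.+1) : Tn i = T i by rewrite /Tn inord_val.
have e : irk (colseq (c *: mat n v)) x y = irk v x y.
  rewrite -(irk_scale v x y c0); apply: eq_irk => z.
  rewrite -(colseq_mat n_gt0 z pv) !colseqE; apply/rowP => i.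
  by rewrite !mxE.
have [le|lt] := leqP (irk v x y) r.
  left; apply/hP/hX; split; last by rewrite e.
  by rewrite /Gr mxrank_scale_nz.
right.
suff H : lead_vanishing rk T (fun V : 'M[K]_(k, n) => Gr V /\ (irk (colseq V) x y <= r)%N).
  by case: H => p [h1 h2]; exists p; split=> // V /hP/hX; exact: h1.
have [nx|xn] := leqP n x.
  have [||g [g1 g2 g3 g4]] := bN x y; [lia|lia|].
  apply: (@lead_nonwrap _ _ _ _ charK0 n_gt0 rk hrk T sT r x y g) => //; [lia|lia|].
  apply: leq_trans lt _; apply: leq_trans g4 _.
  by apply: leq_sum => i _; rewrite Tc.
have [||g [g1 g2 g3 g4 g5]] := bW x y; [lia|lia|].
apply: (@lead_wrap _ _ _ _ charK0 n_gt0 rk hrk T sT r x y g) => //; first lia.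
apply: leq_trans g5; rewrite -addSn leq_add //.
by apply: leq_sum => i _; rewrite Tc.
Qed.

End Point.

Lemma standard_monomials_basic_intersection (f : int -> int) l (fs : 'I_l -> int -> int)
  (hbasic : forall i, @is_basic K k n (@Pi K k n (fs i)))
  (hPi : forall V : 'M[K]_(k, n), @Pi K k n f V <-> (Gr V /\ forall i, @Pi K k n (fs i) V))
  d (T : 'I_d -> KSub k n) : (0 < d)%N ->
  @Bf K k n rk f d T <-> (ssyt T /\ forall i, @Bf K k n rk (fs i) d T).
Proof.
case: d T => // d T _; split=> [[sT nT]|[sT nT]]; split=> //.
  (* [Pi f] lies in each [Pi (fs i)], so the vanishing ideals are contained the other way round. *)
  move=> i; split=> // h; apply: nT; apply: in_initial_mono h => p Jp V /hPi[_ /(_ i)].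
  exact: Jp.
rewrite tab_monomialE => /in_initial_dvd[p [m [D [Jp lp eM]]]].
have [v [pv gv [c c0 hc] bN bW]] := standard_lead_point sT lp eM.
(* If the rescaled point lies in every [Pi (fs i)], it lies in [Pi f], where [p] vanishes. *)
move/eqP: hc; apply; apply: Jp; apply/hPi; split.
  by rewrite /Gr mxrank_scale_nz.
move=> i; have [//|[p' [h1 h2]]] := basic_lead_or_point sT pv gv bN bW c0 (hbasic i).
have [_ []] := nT i; rewrite tab_monomialE; apply: in_initial_lead h2 => V.
exact: h1.
Qed.

End Initial.

Theorem theorem4p12 (K : closedFieldType) (k n : nat)
  (charK0 : [pchar K] =i pred0) (hk : (1 <= k < n)%N)
  (rk : KSub k n -> nat) (hrk : lin_ext rk)
  (f : int -> int) (hf : isBound k n f)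
  (l : nat) (fs : 'I_l -> int -> int)
  (hfs : forall i, isBound k n (fs i))
  (hbasic : forall i, @is_basic K k n (@Pi K k n (fs i)))
  (hPi : forall V : 'M[K]_(k, n), @Pi K k n f V <-> (Gr V /\ forall i, @Pi K k n (fs i) V)) :
  forall d : nat, (1 <= d)%N ->
    forall T : 'I_d -> KSub k n,
      @Bf K k n rk f d T <-> (ssyt T /\ forall i, @Bf K k n rk (fs i) d T).
Proof.
case/andP: hk => k0 kn d d0 T.
exact: (standard_monomials_basic_intersection charK0 k0 (ltnW kn) hrk hbasic hPi).
Qed.
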